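(* Let $n\ge1$, $H=\mathrm{SL}_{n+1}$, $G=H\times H$, with $H$ embedded diagonally in $G$, and let $k\in\mathbb{N}=\{0,1,2,\dots\}$. Put $\widetilde{\alpha_i}=(\omega_i-\omega_{i+1},\,\omega_i-\omega_{i-1})$ for $1\le i\le n$ (with $\omega_0=\omega_{n+1}=0$) and $$B(k\omega_1)=\Big\{\sum_{i=1}^n k_i\widetilde{\alpha_i}+(0,-k\omega_n):\ k_i\in\mathbb{Z},\ k\ge k_n\ge\cdots\ge k_1\ge0\Big\}.$$ Then $$P^+_G(k\omega_1)=P^+_G(0)+B(k\omega_1).$$
   Context: Groups are over $\mathbb{C}$. Let $B\subset H$ be the upper triangular Borel subgroup, $T\subset B$ the diagonal torus, $B^-$ the opposite Borel subgroup with $B\cap B^-=T$, and $\omega_1,\dots,\omega_n$ the fundamental weights of $H$ with respect to $B$. Positivity for $G$ is determined by the Borel subgroup $B\times B^-$, so the fundamental weights of $G$ are $(\omega_i,0)$ and $(0,-\omega_i)$, and $P_G^+$ is the set of their $\mathbb{N}$-linear combinations. Thus the weight $(\lambda_1,-\lambda_2)\in P^+_G$, with $\lambda_1,\lambda_2$ dominant for $H$, corresponds to the irreducible $G$-representation $V^H_{\lambda_1}\otimes (V^H_{\lambda_2})^\vee$ (outer tensor product), where $V^H_\lambda$ is the irreducible $H$-representation of highest weight $\lambda$. For $\mu\in P^+_H$, $P^+_G(\mu)=\{\lambda\in P^+_G:m^{G,H}_\lambda(\mu)=1\}$, where $m^{G,H}_\lambda(\mu)$ is the multiplicity of the irreducible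 $H$-representation of highest weight $\mu$ in the restriction to (the diagonal) $H$ of the irreducible $G$-representation of highest weight $\lambda$. In particular $P^+_G(0)$ is generated by the spherical weights $(\omega_i,-\omega_i)$, $1\le i\le n$. *)

(* Defs.v *)
From HB Require Import structures.
From mathcomp Require Import all_boot all_order all_algebra.
From mathcomp Require Import classical_sets reals complex.
From mathcomp Require Import mpoly.

Set Implicit Arguments.
Unset Strict Implicit.
Unset Printing Implicit Defensive.

Import GRing.Theory.
Local Open Scope classical_set_scope.
Local Open Scope ring_scope.

Record SL (F : fieldType) (N : nat) :=
  MkSL { SLval :> 'M[F]_N ; SL_det : \det SLval == 1 }.

HB.instance Definition _ (F : fieldType) (N : nat) :=
  [isSub for @SLval F N].
HB.instance Definition _ (F : fieldType) (N : nat) :=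
  [Choice of SL F N by <:].

Lemma SL1_subproof (F : fieldType) (N : nat) : \det (1%:M : 'M[F]_N) == 1.
Proof. by rewrite det1. Qed.

Lemma SLM_subproof (F : fieldType) (N : nat) (g h : SL F N) :
  \det (SLval g *m SLval h) == 1.
Proof. by rewrite det_mulmx (eqP (SL_det g)) (eqP (SL_det h)) mulr1. Qed.

Lemma SLV_subproof (F : fieldType) (N : nat) (g : SL F N) :
  \det (invmx (SLval g)) == 1.
Proof. by rewrite det_inv (eqP (SL_det g)) invr1. Qed.

Lemma SL_unitmx (F : fieldType) (N : nat) (g : SL F N) : SLval g \in unitmx.
Proof. by rewrite unitmxE (eqP (SL_det g)) unitr1. Qed.

Definition SLone (F : fieldType) (N : nat) : SL F N :=
  MkSL (SL1_subproof F N).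
Definition SLmul (F : fieldType) (N : nat) (g h : SL F N) : SL F N :=
  MkSL (SLM_subproof g h).
Definition SLinv (F : fieldType) (N : nat) (g : SL F N) : SL F N :=
  MkSL (SLV_subproof g).

Lemma SLmulA (F : fieldType) (N : nat) : associative (@SLmul F N).
Proof. by move=> x y z; apply: val_inj; rewrite /= mulmxA. Qed.

Lemma SLmul1 (F : fieldType) (N : nat) : left_id (SLone F N) (@SLmul F N).
Proof. by move=> x; apply: val_inj; rewrite /= mul1mx. Qed.

Lemma SLmulr1 (F : fieldType) (N : nat) : right_id (SLone F N) (@SLmul F N).
Proof. by move=> x; apply: val_inj; rewrite /= mulmx1. Qed.

Lemma SLmulV (F : fieldType) (N : nat) :
  left_inverse (SLone F N) (@SLinv F N) (@SLmul F N).
Proof. by move=> x; apply: val_inj; rewrite /= mulVmx ?SL_unitmx. Qed.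

Lemma SLmulrV (F : fieldType) (N : nat) :
  right_inverse (SLone F N) (@SLinv F N) (@SLmul F N).
Proof. by move=> x; apply: val_inj; rewrite /= mulmxV ?SL_unitmx. Qed.

HB.instance Definition _ (F : fieldType) (N : nat) :=
  isGroup.Build (SL F N) (@SLmulA F N) (@SLmul1 F N) (@SLmulr1 F N)
    (@SLmulV F N) (@SLmulrV F N).

Definition upper_triangular (F : fieldType) (N : nat) (g : 'M[F]_N) : bool :=
  is_trig_mx g^T.

(* [is_trig_mx] is lower triangularity. *)
Definition lower_triangular (F : fieldType) (N : nat) (g : 'M[F]_N) : bool :=
  is_trig_mx g.

(* [coord] lists the coordinates of a closed embedding of the affine algebraic
   group gT into an affine space; the regular functions on gT are the
   restrictions of polynomials. On SL_N no inverse determinant is needed. *)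
Definition regular_fun (F : fieldType) (gT : Type) (m : nat)
    (coord : gT -> 'I_m -> F) (f : gT -> F) : Prop :=
  exists p : {mpoly F[m]}, forall g, f g = p.@[coord g].

Definition SL_coord (F : fieldType) (N : nat) (g : SL F N) :
    'I_(N * N) -> F :=
  fun i => mxvec (SLval g) 0 i.

Definition SLxSL_coord (F : fieldType) (N : nat) (g : SL F N * SL F N) :
    'I_(N * N + N * N) -> F :=
  fun i => row_mx (mxvec (SLval g.1)) (mxvec (SLval g.2)) 0 i.

(* Finite-dimensional algebraic representations, acting on the left on column
   vectors. *)
Definition rational_rep (F : fieldType) (gT : groupType) (m : nat)
    (coord : gT -> 'I_m -> F) (d : nat) (rho : gT -> 'M[F]_d) : Prop :=
  [/\ rho 1%g = 1%:M,
      (forall g h, rho (g * h)%g = rho g *m rho h)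
    & (forall i j, regular_fun coord (fun g => rho g i j))].

Definition irreducible_rep (F : fieldType) (gT : groupType) (d : nat)
    (rho : gT -> 'M[F]_d) : Prop :=
  (0 < d)%N /\
  (forall W : {vspace 'cV[F]_d},
     (forall g v, v \in W -> rho g *m v \in W) -> W = 0%VS \/ W = fullv).

(* m is the dimension of the space of intertwiners from sigma to rho; for
   sigma irreducible it is the multiplicity of sigma in rho. *)
Definition dim_Hom (F : fieldType) (gT : groupType) (dW dV : nat)
    (sigma : gT -> 'M[F]_dW) (rho : gT -> 'M[F]_dV) (m : nat) : Prop :=
  exists2 U : {vspace 'M[F]_(dV, dW)},
    (forall A, A \in U <-> (forall g, rho g *m A = A *m sigma g))
    & \dim U = m.

(* The weight lattice of SL_(n+1) is identified with Z^n through the basis of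
   fundamental weights; [omega n 0] and [omega n n.+1] are 0. *)
Definition omega (n i : nat) : 'rV[int]_n := \row_j (j.+1 == i)%:R.

(* omega_i is the character t |-> t_1 ... t_i of the diagonal torus; [wt_eval]
   reads the diagonal only, so on either Borel subgroup it is the extension of
   the character from the torus that is trivial on the unipotent radical. *)
Definition wt_eval (F : fieldType) (n : nat) (lam : 'rV[int]_n)
    (b : 'M[F]_n.+1) : F :=
  \prod_(i < n) (\prod_(j < n.+1 | (j <= i)%N) b j j) ^ (lam 0 i).

Definition H_irrep (F : fieldType) (n : nat) (lam : 'rV[int]_n) (d : nat)
    (rho : SL F n.+1 -> 'M[F]_d) : Prop :=
  [/\ rational_rep (@SL_coord F n.+1) rho, irreducible_rep rho
    & exists2 v : 'cV[F]_d, v != 0 &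
        forall b : SL F n.+1, upper_triangular b ->
          rho b *m v = wt_eval lam b *: v].

(* For G = SL_(n+1) x SL_(n+1) the highest weight is taken with respect to the
   Borel subgroup B x B^-. *)
Definition G_irrep (F : fieldType) (n : nat)
    (lam : 'rV[int]_n * 'rV[int]_n) (d : nat)
    (rho : SL F n.+1 * SL F n.+1 -> 'M[F]_d) : Prop :=
  [/\ rational_rep (@SLxSL_coord F n.+1) rho, irreducible_rep rho
    & exists2 v : 'cV[F]_d, v != 0 &
        forall b b' : SL F n.+1, upper_triangular b -> lower_triangular b' ->
          rho (b, b') *m v = (wt_eval lam.1 b * wt_eval lam.2 b') *: v].

(* An irreducible representation is determined up to isomorphism by its highest
   weight, so the choice of rho and sigma is immaterial. *)
Definition branching_mult (F : fieldType) (n : nat)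
    (lam : 'rV[int]_n * 'rV[int]_n) (mu : 'rV[int]_n) (m : nat) : Prop :=
  exists (dV : nat) (rho : SL F n.+1 * SL F n.+1 -> 'M[F]_dV)
         (dW : nat) (sigma : SL F n.+1 -> 'M[F]_dW),
    [/\ G_irrep lam rho, H_irrep mu sigma
      & dim_Hom sigma (fun h => rho (h, h)) m].

Definition PG (n : nat) : set ('rV[int]_n * 'rV[int]_n) :=
  [set lam | exists a b : nat -> nat,
     lam = \sum_(1 <= i < n.+1) (omega n i, 0) *+ a i
         + \sum_(1 <= i < n.+1) (0, - omega n i) *+ b i].

Arguments PG n : clear implicits.

Definition PG_mu (F : fieldType) (n : nat) (mu : 'rV[int]_n) :
    set ('rV[int]_n * 'rV[int]_n) :=
  [set lam | PG n lam /\ branching_mult F lam mu 1].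

Definition alpha_tilde (n i : nat) : 'rV[int]_n * 'rV[int]_n :=
  (omega n i - omega n i.+1, omega n i - omega n i.-1).

Definition B_komega1 (n k : nat) : set ('rV[int]_n * 'rV[int]_n) :=
  [set lam | exists c : nat -> int,
     [/\ 0 <= c 1%N,
         (forall i, (1 <= i < n)%N -> c i <= c i.+1),
         c n <= k%:Z
       & lam = \sum_(1 <= i < n.+1) alpha_tilde n i *~ c i
             + (0, - (omega n n *+ k))]].
Arguments B_komega1 n k : clear implicits.

(* Main.v *)
(* Write N = n+1. Everything is expressed through matrix coefficients
   g |-> xi (rho g v), where v is a highest weight vector and xi an eigenfunctional
   of the opposite Borel subgroup: on the (dense) big cell such a coefficient is
   determined by the weight, and it determines the representation.

   An intertwiner A from V_(k omega_1) to the restriction of V_lam is determined by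
   h |-> xi (A (h w)), a form of degree k in the first column of h which is a weight
   vector of the torus, hence a multiple of a monomial z^m. This bounds the
   multiplicity by 1; comparing weights gives lam.1 + lam.2 = sum_j m_j epsilon_j, and
   an SL_2 argument bounds m_(j+1) by the j-th coefficient of - lam.2: this is the
   Pieri rule.

   Conversely, the product over j of the m_j-th powers of the minors
   det (first j rows of x * [first j-1 columns of y^-1 | h e_1]) and of powers of the
   leading minors of x y^-1 is an invariant function on G x H which gives a nonzero
   intertwiner; that it lies in the irreducible representation follows from a positive
   definite Hermitian form, which splits off the span of the translates of the highest
   weight coefficient. *)
Require Import Defs.
From mathcomp Require Import all_boot all_order all_algebra all_fingroup.
From mathcomp Require Import boolp classical_sets reals complex mpoly.
From mathcomp Require Import ring zify.

Set Implicit Arguments.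
Unset Strict Implicit.
Unset Printing Implicit Defensive.

Import Order.TTheory GRing.Theory Num.Theory.
Local Open Scope ring_scope.

(** * Regular functions, and bases extracted from spanning families *)

(** The link with $B(k\omega_1)$ is telescoping. With $k_0=0$ and $k_{n+1}=k$, the tuples
    $m_i=k_{i+1}-k_i$, $0\le i\le n$, are exactly the tuples of naturals with sum $k$, and an
    element of $B(k\omega_1)$ has coefficients $m_{i-1}$ and $-m_i$ at $\omega_i$ in its two
    components. Adding a spherical weight adds an arbitrary partition to both sides of the Pieri
    condition. The same criterion with $k=0$ describes $P_G^+(0)$. Multiplicity one must be
    witnessed by actual irreducible modules, and a tensor product of fundamental modules is not
    irreducible. So only highest weight coefficients are multiplied, and a module is recovered at
    the end from a factorization of the product. As weights add under products, two families
    suffice: $(\omega_i,-\omega_i)$ in degree 0 and $(\omega_{i+1},-\omega_i)$ in degree 1.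
    Nonvanishing survives because all the invariants are nonzero at the same points: the identity of
    $G$ with any $h$ whose first column consists of ones. A matrix of determinant 1 cannot rescale a
    single coordinate; homogeneity and $N$-th roots make up for this. *)

Section RegularFunctions.
Variables (F : fieldType) (gT : Type) (m : nat) (coord : gT -> 'I_m -> F).
Local Notation reg := (regular_fun coord).

Lemma regular_ext f f' : f =1 f' -> reg f -> reg f'.
Proof. by move=> ff' [p fp]; exists p => g; rewrite -ff'. Qed.

Lemma regular_const c : reg (fun=> c).
Proof. by exists c%:MP => g; rewrite mevalC. Qed.

Lemma regular_coord i : reg (fun g => coord g i).
Proof. by exists 'X_i => g; rewrite mevalXU. Qed.

Lemma regularD f f' : reg f -> reg f' -> reg (fun g => f g + f' g).
Proof. by move=> [p fp] [p' fp']; exists (p + p') => g; rewrite mevalD fp fp'. Qed.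

Lemma regularM f f' : reg f -> reg f' -> reg (fun g => f g * f' g).
Proof. by move=> [p fp] [p' fp']; exists (p * p') => g; rewrite mevalM fp fp'. Qed.

Lemma regularB f f' : reg f -> reg f' -> reg (fun g => f g - f' g).
Proof. by move=> [p fp] [p' fp']; exists (p - p') => g; rewrite mevalB fp fp'. Qed.

Lemma regular_sum (I : Type) (r : seq I) (P : pred I) (f : I -> gT -> F) :
  (forall i, P i -> reg (f i)) -> reg (fun g => \sum_(i <- r | P i) f i g).
Proof.
move=> fP; elim: r => [|i r IHr].
  by apply: regular_ext (regular_const 0) => g; rewrite big_nil.
case Pi: (P i); last by apply: regular_ext IHr => g; rewrite big_cons Pi.
by apply: regular_ext (regularD (fP i Pi) IHr) => g; rewrite big_cons Pi.
Qed.

Lemma regular_prod (I : Type) (r : seq I) (P : pred I) (f : I -> gT -> F) :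
  (forall i, P i -> reg (f i)) -> reg (fun g => \prod_(i <- r | P i) f i g).
Proof.
move=> fP; elim: r => [|i r IHr].
  by apply: regular_ext (regular_const 1) => g; rewrite big_nil.
case Pi: (P i); last by apply: regular_ext IHr => g; rewrite big_cons Pi.
by apply: regular_ext (regularM (fP i Pi) IHr) => g; rewrite big_cons Pi.
Qed.

Lemma regularX f n : reg f -> reg (fun g => f g ^+ n).
Proof.
move=> rf; elim: n => [|n IHn].
  by apply: regular_ext (regular_const 1) => g; rewrite expr0.
by apply: regular_ext (regularM rf IHn) => g; rewrite exprS.
Qed.

Lemma regular_det n (f : 'I_n -> 'I_n -> gT -> F) :
  (forall i j, reg (f i j)) -> reg (fun g => \det (\matrix_(i, j) f i j g)).
Proof.
move=> rf; apply: regular_sum => s _; apply: regularM; first exact: regular_const.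
by apply: regular_prod => i _; apply: regular_ext (rf i _) => g; rewrite mxE.
Qed.

(** Induction on the polynomial behind [f], pulled back along a family [c]. Since [P] may be any
    property of functions on [T] closed under the operations, it also covers claims that hold only
    away from zeros of a denominator. *)
Lemma regular_ind (T : Type) (P : (T -> F) -> Prop) (c : T -> gT) f :
  (forall h h', h =1 h' -> P h -> P h') -> (forall a, P (fun=> a)) ->
  (forall h h', P h -> P h' -> P (fun t => h t + h' t)) ->
  (forall h h', P h -> P h' -> P (fun t => h t * h' t)) ->
  (forall i, P (fun t => coord (c t) i)) -> reg f -> P (f \o c).
Proof.
move=> Pext Pc PD PM Pcoord [p fp].
apply: (Pext (fun t => p.@[coord (c t)])) => [t|]; first by rewrite /= fp.
have -> : (fun t => p.@[coord (c t)]) =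
    (fun t => \sum_(k <- msupp p) p@_k * \prod_(i < m) coord (c t) i ^+ k i).
  by apply/funext => t; rewrite mevalE.
elim: (msupp p) => [|k s IHs].
  by apply: Pext (Pc 0) => t; rewrite big_nil.
apply: (Pext (fun t => p@_k * \prod_(i < m) coord (c t) i ^+ k i +
    \sum_(k <- s) p@_k * \prod_(i < m) coord (c t) i ^+ k i)) => [t|].
  by rewrite big_cons.
apply/PD/IHs/PM => //.
elim: (index_enum _) => [|i r IHr]; first by apply: Pext (Pc 1) => t; rewrite big_nil.
apply: (Pext (fun t => coord (c t) i ^+ k i *
    \prod_(i <- r) coord (c t) i ^+ k i)) => [t|]; first by rewrite big_cons.
apply: (PM) => //; elim: (k i) => [|j IHj]; first by apply: (Pext _ _ _ (Pc 1)) => t.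
by apply: (Pext _ _ _ (PM _ _ (Pcoord i) IHj)) => t; rewrite exprS.
Qed.

End RegularFunctions.

Lemma regular_comp (F : fieldType) (gT hT : Type) m n (cg : gT -> 'I_m -> F)
    (ch : hT -> 'I_n -> F) (c : hT -> gT) f :
  (forall i, regular_fun ch (fun h => cg (c h) i)) ->
  regular_fun cg f -> regular_fun ch (f \o c).
Proof.
move=> rc; apply: regular_ind => //.
- exact: regular_ext.
- exact: regular_const.
- exact: regularD.
- exact: regularM.
Qed.

(** In characteristic 0 the natural numbers give [p * d] more roots than its degree allows. *)
Lemma poly_eq0_cofinite (F : numFieldType) (p d : {poly F}) :
  d != 0 -> (forall x, d.[x] != 0 -> p.[x] = 0) -> p = 0.
Proof.
move=> d0 pd; have [//|p0] := eqVneq p 0.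
have pd0 : p * d != 0 by rewrite mulf_neq0.
pose s : seq F := [seq k%:R | k <- iota 0 (size (p * d))].
have := @max_poly_roots _ (p * d) s pd0.
rewrite map_inj_uniq ?iota_uniq; last by move=> x y /eqP; rewrite eqr_nat => /eqP.
rewrite size_map size_iota ltnn => H.
suff : false by []; apply: H => //; apply/allP => x _; rewrite rootE hornerM.
by have [->|/pd->] := eqVneq d.[x] 0; rewrite ?mulr0 ?mul0r.
Qed.

Lemma poly_eq0_punctured (F : numFieldType) (p : {poly F}) :
  (forall x, x != 0 -> p.[x] = 0) -> p = 0.
Proof.
move=> p0; apply: (@poly_eq0_cofinite _ p 'X); first by rewrite polyX_eq0.
by move=> x; rewrite hornerX => /p0.
Qed.

(** A free family of values of maximal length exists because the rank is bounded; it spans, since a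
    value outside its span could be appended. *)
Lemma extract_row_base (F : fieldType) (T : Type) (m : nat) (f : T -> 'rV[F]_m) :
  exists d (h : 'I_d -> T), row_free (\matrix_l f (h l)) /\
    forall x, (f x <= \matrix_l f (h l))%MS.
Proof.
pose P d := exists h : 'I_d -> T, row_free (\matrix_l f (h l)).
have P0 : exists d, `[< P d >].
  exists 0%N; apply/asboolP; exists (fun i : 'I_0 => False_rect T (notF (ltn_ord i))).
  by rewrite /row_free -leqn0 rank_leq_row.
have Pm d : `[< P d >] -> (d <= m)%N.
  by move=> /asboolP[h /eqP <-]; exact: rank_leq_col.
case: (ex_maxnP P0 Pm) => d /asboolP[h hfree] dmax.
exists d, h; split=> // x; apply: contraT => nx; exfalso.
have: (d + 1 <= d)%N; last by rewrite addn1 ltnn.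
apply/dmax/asboolP.
exists (fun l => match split l with inl a => h a | inr _ => x end).
have -> : \matrix_l f (match split l with inl a => h a | inr _ => x end) =
          col_mx (\matrix_l f (h l)) (f x).
  apply/row_matrixP => i; rewrite rowK.
  case: (split_ordP i) => a ->.
    by rewrite rowKu rowK.
  by rewrite rowKd row_id.
rewrite -row_leq_rank [leqLHS]addn1 -[in leqLHS](eqP hfree); apply: rank_ltmx.
rewrite ltmxE; apply/andP; split; first by rewrite -addsmxE addsmxSl.
by apply: contra nx => colB; apply: submx_trans colB; rewrite -addsmxE addsmxSr.
Qed.

Lemma extract_row_basis (F : fieldType) (T : Type) (m : nat) (f : T -> 'rV[F]_m) :
  (forall v : 'cV_m, (forall x, f x *m v = 0) -> v = 0) ->
  exists h : 'I_m -> T, \matrix_l f (h l) \in unitmx.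
Proof.
move=> fspan; have [d [h [hfree hspan]]] := extract_row_base f.
have hfull : row_full (\matrix_l f (h l)).
  rewrite -cokermx_eq0; apply/eqP/matrixP => i j; rewrite mxE.
  have: col j (cokermx (\matrix_l f (h l))) = 0.
    apply: fspan => x; have /submxP[D ->] := hspan x.
    by rewrite colE mulmxA -(mulmxA D) mulmx_coker mulmx0 mul0mx.
  by move/matrixP/(_ i 0); rewrite !mxE.
have dm : d = m by rewrite -(eqP hfree) (eqP hfull).
by subst d; exists h; rewrite -row_free_unit.
Qed.

Lemma extract_col_basis (F : fieldType) (T : Type) (m : nat) (f : T -> 'cV[F]_m) :
  (forall v : 'rV_m, (forall x, v *m f x = 0) -> v = 0) ->
  exists h : 'I_m -> T, \matrix_(i, l) f (h l) i 0 \in unitmx.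
Proof.
move=> fspan.
have [v fv|h hu] := @extract_row_basis F T m (fun x => (f x)^T).
  apply: (can_inj (@trmxK _ _ _)); rewrite trmx0; apply: fspan => x.
  by apply: (can_inj (@trmxK _ _ _)); rewrite trmx_mul trmxK fv trmx0.
exists h; rewrite -unitmx_tr; congr (_ \in unitmx): hu.
by apply/matrixP => i j; rewrite !mxE.
Qed.

Lemma row_functional_mem (F : fieldType) d (W : {vspace 'cV[F]_d}) (x : 'cV_d) :
  (forall eta : 'rV_d, (forall w, w \in W -> eta *m w = 0) -> eta *m x = 0) ->
  x \in W.
Proof.
move=> Wx; suff -> : x = projv W x by exact: memv_proj.
apply/matrixP => i j; rewrite ord1 {j}.
(* The [i]-th coordinate of $y-\mathrm{proj}_W(y)$, as a functional of $y$; it vanishes on [W]. *)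
pose eta : 'rV_d := \row_k (delta_mx k 0 - projv W (delta_mx k 0)) i 0.
have etaE y : (eta *m y) 0 0 = (y - projv W y) i 0.
  rewrite [y in RHS]matrix_sum_delta; under eq_bigr do rewrite big_ord1.
  rewrite linear_sum -sumrB summxE mxE.
  by apply: eq_bigr => k _; rewrite linearZ -scalerBr /= [in RHS]mxE mxE mulrC.
have: (eta *m x) 0 0 = 0.
  rewrite Wx ?mxE // => w wW; apply/matrixP => a b; rewrite !ord1 etaE.
  by rewrite projv_id // subrr !mxE.
by rewrite etaE mxE [X in _ + X]mxE => /eqP; rewrite subr_eq0 => /eqP.
Qed.

(** * Big cells and irreducibility *)

Lemma mx_scalar0 (F : fieldType) (A : 'M[F]_1) : A 0 0 = 0 -> A = 0.
Proof. by move=> A0; apply/matrixP => i j; rewrite !ord1 A0 mxE. Qed.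

Lemma regular_mxcoef (F : fieldType) (gT : groupType) m (coord : gT -> 'I_m -> F)
    d (rho : gT -> 'M[F]_d) (eta : 'rV_d) (v : 'cV_d) :
  rational_rep coord rho -> regular_fun coord (fun g => (eta *m (rho g *m v)) 0 0).
Proof.
move=> [_ _ rreg].
apply: (@regular_ext _ _ _ _ (fun g => \sum_i \sum_j eta 0 i * v j 0 * rho g i j)).
  move=> g; rewrite mxE; apply: eq_bigr => i _; rewrite mxE big_distrr /=.
  by apply: eq_bigr => j _; rewrite -mulrA (mulrC (v j 0)).
do 2!apply: regular_sum => ? _; apply: regularM => //; exact: regular_const.
Qed.

(* [Bp] and [Bm] play the roles of opposite Borel subgroups and [chi] that of a
   character of both; the last condition says that conjugation by a cocharacter
   contracts [Bm] to a torus inside [Bp]. *)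
Record big_cell (F : fieldType) (gT : groupType) m (coord : gT -> 'I_m -> F)
    (Bp Bm : gT -> Prop) (chi : gT -> F) : Prop := BigCell {
  big_cell1 : Bm 1%g;
  big_cellM : forall u u', Bm u -> Bm u' -> Bm (u * u')%g;
  big_cell_chiM : forall u u', Bm u -> Bm u' -> chi (u * u')%g = chi u * chi u';
  big_cell_chi1 : chi 1%g = 1;
  big_cell_dense : forall f, regular_fun coord f ->
    (forall u b, Bm u -> Bp b -> f (u * b)%g = 0) -> forall g, f g = 0;
  big_cell_contract : exists2 tau : F -> gT,
    (forall s, s != 0 -> Bp (tau s) /\ chi (tau s) != 0) &
    forall u, Bm u -> exists2 u0, Bp u0 /\ chi u0 = chi u &
      forall f, regular_fun coord f -> exists2 q : {poly F},
        (forall s, s != 0 -> f (tau s * u * (tau s)^-1)%g = q.[s]) & f u0 = q.[0]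
}.

Definition eigencol (F : fieldType) (gT : Type) d (rho : gT -> 'M[F]_d)
    (B : gT -> Prop) (chi : gT -> F) (v : 'cV_d) :=
  forall b, B b -> rho b *m v = chi b *: v.

Definition eigenrow (F : fieldType) (gT : Type) d (rho : gT -> 'M[F]_d)
    (B : gT -> Prop) (chi : gT -> F) (xi : 'rV_d) :=
  forall b, B b -> xi *m rho b = chi b *: xi.

Definition cyclic_col (F : fieldType) (gT : Type) d (rho : gT -> 'M[F]_d) (v : 'cV_d) :=
  forall eta : 'rV_d, (forall g, eta *m (rho g *m v) = 0) -> eta = 0.

Definition cyclic_row (F : fieldType) (gT : Type) d (rho : gT -> 'M[F]_d) (xi : 'rV_d) :=
  forall x : 'cV_d, (forall g, xi *m (rho g *m x) = 0) -> x = 0.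

(** The span of a nonzero stable set is a nonzero submodule, hence everything. [S] may be infinite,
    so finitely many generators are extracted before forming the span. *)
Lemma irreducible_stable_set (F : fieldType) (gT : groupType) d
    (rho : gT -> 'M[F]_d) (S : 'cV_d -> Prop) :
  irreducible_rep rho -> (forall g x, S x -> S (rho g *m x)) ->
  forall x0, S x0 -> x0 != 0 ->
  forall eta : 'rV_d, (forall x, S x -> eta *m x = 0) -> eta = 0.
Proof.
move=> [_ rirr] Sst x0 Sx0 x0n0 eta etaS.
have [e [h [_ hspan]]] := @extract_row_base F {x | S x} d (fun x => (sval x)^T).
pose s := [seq sval (h l) | l <- enum 'I_e].
have memS x : S x -> x \in <<s>>%VS.
  move=> Sx; have /submxP[D xD] := hspan (exist _ x Sx).
  have -> : x = \sum_l D 0 l *: sval (h l).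
    apply: (can_inj (@trmxK _ _ _)); rewrite [LHS]xD; apply/matrixP => i j.
    rewrite !mxE ord1 summxE; apply: eq_bigr => l _.
    by rewrite !mxE.
  apply: memv_suml => l _; apply: memvZ; apply: memv_span; apply: map_f.
  by rewrite mem_enum.
have in_s i : (i < size s)%N -> S s`_i.
  move=> lti; have /mapP[l _ ->] := mem_nth 0 lti; exact: svalP (h l).
have [|W0|Wfull] := rirr <<s>>%VS.
- move=> g x /coord_span ->; rewrite mulmx_sumr; apply: memv_suml => i _.
  rewrite -scalemxAr; apply: memvZ; apply: (memS); apply: (Sst); apply: (in_s).
  by rewrite size_map -cardE ltn_ord.
- by have := memS _ Sx0; rewrite W0 memv0 (negPf x0n0).
- apply/matrixP => i j; rewrite ord1 [RHS]mxE.
  have : delta_mx j 0 \in <<s>>%VS by rewrite Wfull memvf.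
  move=> /coord_span dE; have := congr1 (fun x => (eta *m x) 0 0) dE.
  rewrite -colE mxE => ->; rewrite mulmx_sumr summxE big1 // => k _.
  rewrite -scalemxAr etaS ?scaler0 ?mxE //; apply: (in_s).
  by rewrite size_map -cardE ltn_ord.
Qed.

Section BigCell.
Variables (F : numFieldType) (gT : groupType) (m : nat) (coord : gT -> 'I_m -> F).
Variables (Bp Bm : gT -> Prop) (chi : gT -> F).
Hypothesis cell : big_cell coord Bp Bm chi.
Variables (d : nat) (rho : gT -> 'M[F]_d).
Hypothesis rho_rat : rational_rep coord rho.

(** Act by [tau s]. As [tau s] lies in [Bp], moving it through to [v] costs only the scalar
    [chi (tau s)] and replaces each [u l] by its conjugate. Applying [eta] gives a polynomial in [s]
    that vanishes for all nonzero [s], hence also at 0, where each conjugate degenerates to an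
    element of [Bp] acting on [v] by [chi (u l)]. *)
Lemma contraction_limit (v : 'cV_d) (L : nat) (c : 'I_L -> F) (u : 'I_L -> gT)
    (eta : 'rV_d) :
  eigencol rho Bp chi v -> (forall l, Bm (u l)) ->
  (forall g, eta *m (rho g *m \sum_l c l *: (rho (u l) *m v)) = 0) ->
  (\sum_l c l * chi (u l)) *: (eta *m v) = 0.
Proof.
move=> vB uB eta0; have [_ rhoM _] := rho_rat.
have [tau tauP tauC] := big_cell_contract cell.
pose f g := (eta *m (rho g *m v)) 0 0.
have fr : regular_fun coord f by exact: regular_mxcoef.
have /choice[q qP] l : exists q : {poly F},
    (forall s, s != 0 -> f (tau s * u l * (tau s)^-1)%g = q.[s]) /\
    q.[0] = chi (u l) * (eta *m v) 0 0.
  have [u0 [u0B u0chi] /(_ _ fr)[q qs q0]] := tauC _ (uB l).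
  by exists q; split=> //; rewrite -q0 /f vB // -scalemxAr mxE u0chi.
have q0 : \sum_l c l *: q l = 0.
  apply: poly_eq0_punctured => s s0; have [tB chi0] := tauP s s0.
  apply: (mulfI chi0); have := congr1 (fun A : 'M_1 => A 0 0) (eta0 (tau s)).
  rewrite mulr0 /= [X in _ = X]mxE => <-; rewrite horner_sum mulr_sumr !mulmx_sumr.
  rewrite summxE; apply: eq_bigr => l _.
  rewrite hornerZ -(qP l).1 // /f mulrCA -!scalemxAr [RHS]mxE; congr (_ * _).
  have -> : rho (tau s) *m (rho (u l) *m v) =
      chi (tau s) *: (rho (tau s * u l * (tau s)^-1)%g *m v).
    rewrite mulmxA -rhoM -[in LHS](mulgVK (tau s) (tau s * u l)%g).
    by rewrite rhoM -mulmxA vB // -scalemxAr.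
  by rewrite -scalemxAr [RHS]mxE.
apply: mx_scalar0; rewrite mxE mulr_suml.
have := congr1 (fun p => p.[0]) q0; rewrite horner0 => {2}<-.
by rewrite horner_sum; apply: eq_bigr => l _; rewrite hornerZ (qP l).2 mulrA.
Qed.

(** Elements of [Bp] only rescale [v], so by density of the products of [Bm] and [Bp] the translates
    under [Bm] alone already span. *)
Lemma cyclic_col_Bm (v : 'cV_d) : eigencol rho Bp chi v -> cyclic_col rho v ->
  exists2 u : 'I_d -> gT, (forall l, Bm (u l)) &
    \matrix_(i, l) (rho (u l) *m v) i 0 \in unitmx.
Proof.
move=> vB vcyc; have [_ rhoM _] := rho_rat.
have [eta eta0|h hu] :=
    @extract_col_basis F {u | Bm u} d (fun u => rho (sval u) *m v).
  apply: vcyc => g; apply: mx_scalar0.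
  apply: (big_cell_dense cell (regular_mxcoef eta v rho_rat)) => u b uB bB.
  by rewrite rhoM -mulmxA vB // -!scalemxAr (eta0 (exist _ u uB)) scaler0 mxE.
by exists (fun l => sval (h l)) => // l; exact: svalP (h l).
Qed.

(** The functional must send [rho w *m v] to [chi w] for [w] in [Bm]. It is prescribed on a basis of
    such translates; contraction shows that every linear relation among translates is respected, so
    the formula holds for all [w]. *)
Lemma exists_eigenrow (v : 'cV_d) : v != 0 ->
  eigencol rho Bp chi v -> cyclic_col rho v ->
  exists2 xi : 'rV_d, eigenrow rho Bm chi xi & xi *m v = 1%:M.
Proof.
move=> v0 vB vcyc; have [rho1 rhoM _] := rho_rat.
have [u uB] := cyclic_col_Bm vB vcyc; set M := (X in X \in unitmx) => Mu.
have ME (c : 'cV_d) : M *m c = \sum_l c l 0 *: (rho (u l) *m v).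
  apply/matrixP => i j; rewrite ord1 mxE summxE; apply: eq_bigr => l _.
  by rewrite !mxE mulrC.
pose xi : 'rV_d := \row_l chi (u l) *m invmx M.
have xiE w : Bm w -> xi *m (rho w *m v) = (chi w)%:M.
  move=> wB; pose c := invmx M *m (rho w *m v).
  have cE : \sum_l c l 0 *: (rho (u l) *m v) = rho w *m v by rewrite -ME mulKVmx.
  have key : (chi w - \sum_l c l 0 * chi (u l)) *: v = 0.
    apply/matrixP => i j; rewrite ord1 [RHS]mxE.
    (* The translate by [w] is put in front of the basis, so that its expansion becomes a relation
       with sum 0. *)
    pose u' (l : 'I_d.+1) := if unlift 0 l is Some l' then u l' else w.
    pose c' (l : 'I_d.+1) := if unlift 0 l is Some l' then - c l' 0 else 1.
    have xE : \sum_l c' l *: (rho (u' l) *m v) = 0.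
      rewrite big_ord_recl /u' /c' unlift_none scale1r.
      by under eq_bigr do rewrite liftK scaleNr; rewrite sumrN cE subrr.
    have chiE : \sum_l c' l * chi (u' l) = chi w - \sum_l c l 0 * chi (u l).
      rewrite big_ord_recl /u' /c' unlift_none mul1r.
      by under eq_bigr do rewrite liftK mulNr; rewrite sumrN.
    have := @contraction_limit v _ c' u' (delta_mx 0 i) vB.
    rewrite xE chiE => H.
    have H' : (chi w - \sum_l c l 0 * chi (u l)) *: ((delta_mx 0 i : 'rV_d) *m v) = 0.
      by apply: H => [l|g]; [rewrite /u'; case: unlift|rewrite !mulmx0].
    by move/matrixP/(_ 0 0): H'; rewrite -rowE !mxE.
  have -> : xi *m (rho w *m v) = \row_l chi (u l) *m c by rewrite /xi -mulmxA.
  apply/matrixP => i j; rewrite !ord1 !mxE eqxx mulr1n.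
  move/eqP: key; rewrite scaler_eq0 (negPf v0) orbF subr_eq0 => /eqP ->.
  by apply: eq_bigr => l _; rewrite mxE mulrC.
exists xi; last by rewrite -(big_cell_chi1 cell) -xiE ?rho1 ?mul1mx //; exact: big_cell1 cell.
move=> w wB; apply: (can_inj (mulmxK Mu)); apply/matrixP => i j.
have colM : col j M = rho (u j) *m v by apply/matrixP => a b; rewrite ord1 !mxE.
have entry (A : 'rV_d) : (A *m M) i j = (A *m (rho (u j) *m v)) 0 0.
  by rewrite -colM colE mulmxA -colE !mxE ord1.
rewrite !entry -mulmxA (mulmxA (rho w)) -rhoM xiE; last exact: big_cellM cell _ _ _ _.
by rewrite -scalemxAl xiE // mxE (big_cell_chiM cell) // !mxE eqxx !mulr1n.
Qed.

(** A nonzero submodule contains some [y] with [xi *m y] nonzero. Writing [y] through translates of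
    [v] under [Bm], this value is $\sum_l c_l\chi(u_l)$ times [xi *m v]; the same sum is the
    coefficient with which [v] appears when [y] is contracted. It is nonzero, so [v] lies in the
    submodule. *)
Lemma irreducible_of_cyclic (v : 'cV_d) (xi : 'rV_d) :
  eigencol rho Bp chi v -> cyclic_col rho v ->
  eigenrow rho Bm chi xi -> cyclic_row rho xi -> xi *m v != 0 ->
  irreducible_rep rho.
Proof.
move=> vB vcyc xiB xicyc xiv0; have [rho1 rhoM _] := rho_rat.
split=> [|W Wst].
  rewrite lt0n; apply: contraNneq xiv0 => d0; apply/eqP/matrixP => i j.
  by rewrite mxE big1 ?mxE // => l; move: (ltn_ord l); rewrite {2}d0.
have [W0|[x xW x0]] : W = 0%VS \/ exists2 x, x \in W & x != 0.
- have [->|Wn0] := eqVneq W 0%VS; first by left.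
  by right; exists (vpick W); rewrite ?memv_pick ?vpick0.
- by left.
right.
have [y yW xiy] : exists2 y, y \in W & xi *m y != 0.
  apply: contrapT => H; move/eqP: x0; apply; apply: xicyc => g.
  apply/eqP; apply: contrapT => /negP xig; apply: H.
  by exists (rho g *m x) => //; exact: Wst.
have [u uB] := cyclic_col_Bm vB vcyc; set M := (X in X \in unitmx) => Mu.
have ME (c : 'cV_d) : M *m c = \sum_l c l 0 *: (rho (u l) *m v).
  apply/matrixP => i j; rewrite ord1 mxE summxE; apply: eq_bigr => l _.
  by rewrite !mxE mulrC.
pose c := invmx M *m y.
have yE : y = \sum_l c l 0 *: (rho (u l) *m v) by rewrite -ME mulKVmx.
have vW : v \in W.
  apply: row_functional_mem => eta etaW.
  have : (\sum_l c l 0 * chi (u l)) *: (eta *m v) = 0.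
    by apply: contraction_limit vB uB _ => g; rewrite -yE etaW // Wst.
  move/eqP; rewrite scaler_eq0 => /orP[/eqP c0|/eqP //].
  case/eqP: xiy; rewrite yE mulmx_sumr.
  under eq_bigr do rewrite -scalemxAr mulmxA xiB // -scalemxAl scalerA.
  by rewrite -scaler_suml c0 scale0r.
apply/eqP; rewrite eqEsubv subvf /=; apply/subvP => x1 _.
apply: row_functional_mem => eta etaW.
by rewrite (vcyc eta) ?mul0mx // => g; apply/etaW/Wst.
Qed.

End BigCell.

(** * Density of the big cell *)

Section Triangular.
Variable F : fieldType.

Lemma trig_mulmx N (A B : 'M[F]_N) :
  is_trig_mx A -> is_trig_mx B -> is_trig_mx (A *m B).
Proof.
move=> /is_trig_mxP tA /is_trig_mxP tB; apply/is_trig_mxP => i j ij.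
rewrite mxE big1 // => k _; case: (ltnP i k) => [/tA->|ki]; first by rewrite mul0r.
by rewrite tB ?mulr0 // (leq_ltn_trans ki).
Qed.

Lemma trig_mulmx_diag N (A B : 'M[F]_N) i :
  is_trig_mx A -> is_trig_mx B -> (A *m B) i i = A i i * B i i.
Proof.
move=> /is_trig_mxP tA /is_trig_mxP tB.
rewrite mxE (bigD1 i) //= big1 ?addr0 // => k ki.
case: (ltngtP i k) => [/tA->|/tB->|/val_inj E]; rewrite ?mul0r ?mulr0 //.
by rewrite E eqxx in ki.
Qed.

Lemma trig_inv N (A B : 'M[F]_N) : A *m B = 1%:M -> is_trig_mx A -> is_trig_mx B.
Proof.
move=> AB tA; have Adiag i : A i i != 0.
  have := congr1 determinant AB; rewrite det_mulmx det1 det_trig // (bigD1 i) //=.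
  by move=> D; apply/eqP => A0; move/eqP: D; rewrite A0 !mul0r eq_sym oner_eq0.
apply/is_trig_mxP => i; have [m] := ubnP (val i); elim: m i => // m IHm i im j ij.
apply: (mulfI (Adiag i)); rewrite mulr0.
move/matrixP/(_ i j): AB; rewrite !mxE (bigD1 i) //= big1 ?addr0 => [->|k ki].
  by case: eqP ij => [->|//]; rewrite ltnn.
case: (ltngtP i k) => [/(is_trig_mxP tA)->|ki'|/val_inj E].
- by rewrite mul0r.
- by rewrite (IHm k) ?mulr0 //; [apply: leq_trans ki' _|apply: ltn_trans ki' _].
- by rewrite E eqxx in ki.
Qed.

Lemma upper_mulmx N (A B : 'M[F]_N) :
  upper_triangular A -> upper_triangular B -> upper_triangular (A *m B).
Proof. by rewrite /upper_triangular trmx_mul => tA tB; exact: trig_mulmx. Qed.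

Lemma upper_mulmx_diag N (A B : 'M[F]_N) i :
  upper_triangular A -> upper_triangular B -> (A *m B) i i = A i i * B i i.
Proof.
move=> tA tB; have := @trig_mulmx_diag _ B^T A^T i tB tA.
by rewrite -trmx_mul !mxE mulrC.
Qed.

Lemma upper_triangularP N (A : 'M[F]_N) :
  reflect (forall i j : 'I_N, (j < i)%N -> A i j = 0) (upper_triangular A).
Proof.
rewrite /upper_triangular.
by apply: (iffP is_trig_mxP) => tA i j ij; have := tA j i ij; rewrite mxE.
Qed.

Lemma wt_evalM n (lam : 'rV[int]_n) (A B C : 'M[F]_n.+1) :
  (forall j, C j j = A j j * B j j) -> wt_eval lam C = wt_eval lam A * wt_eval lam B.
Proof.
move=> dC; rewrite /wt_eval -big_split; apply: eq_bigr => i _ /=.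
by rewrite -expfzMl -big_split; congr (_ ^ _); apply: eq_bigr.
Qed.

Lemma wt_eval_diag n (lam : 'rV[int]_n) (A B : 'M[F]_n.+1) :
  (forall j, A j j = B j j) -> wt_eval lam A = wt_eval lam B.
Proof.
by move=> dA; apply: eq_bigr => i _; congr (_ ^ _); apply: eq_bigr => j _.
Qed.

Lemma wt_eval1 n (lam : 'rV[int]_n) : wt_eval lam (1%:M : 'M[F]_n.+1) = 1.
Proof.
rewrite /wt_eval big1 // => i _; rewrite big1 ?exp1rz // => j _.
by rewrite mxE eqxx.
Qed.

Lemma wt_eval_neq0 n (lam : 'rV[int]_n) (A : 'M[F]_n.+1) :
  (forall j, A j j != 0) -> wt_eval lam A != 0.
Proof.
move=> dA; rewrite prodf_seq_neq0; apply/allP => i _; apply: expfz_neq0.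
by rewrite prodf_seq_neq0; apply/allP => j _; rewrite dA implybT.
Qed.

(* All leading minors are 1 at [t = 0], so none of them vanishes identically. *)
Lemma generic_LU N (M : 'M[{poly F}]_N) : map_mx (horner_eval 0) M = 1%:M ->
  exists2 delta : {poly F}, delta != 0 & forall t, delta.[t] != 0 ->
    exists L U, [/\ is_trig_mx L, upper_triangular U &
      map_mx (horner_eval t) M = L *m U].
Proof.
elim: N M => [M _|N IHN].
  exists 1; rewrite ?oner_eq0 // => t _; exists 1%:M, 1%:M.
  by split; [apply/is_trig_mxP|apply/is_trig_mxP|apply/matrixP] => -[].
rewrite -[N.+1]/(1 + N)%N => M; rewrite -(submxK M).
set ul := ulsubmx M; set ur := ursubmx M; set dl := dlsubmx M; set dr := drsubmx M.
rewrite map_block_mx -[X in _ = X](submxK 1%:M) => /eq_block_mx[ul1 ur0 dl0 dr1].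
pose a := ul 0 0.
(* The Schur complement multiplied by the pivot [a] keeps polynomial entries, and it is still the
   identity at 0 because [a] takes the value 1 there. *)
have [|delta d0 dP] := IHN (a *: dr - dl *m ur).
  rewrite raddfB /= map_mxM ur0 map_mxZ dr1 /=.
  have -> : horner_eval 0 a = 1.
    by move/matrixP/(_ 0 0): ul1; rewrite mxE -/a => ->; rewrite !mxE eqxx.
  apply/matrixP => i j; rewrite !mxE big1 ?subr0 ?mul1r => [|k _].
    by rewrite eq_rshift.
  by rewrite !mxE eq_lrshift mulr0.
exists (a * delta) => [|t]; rewrite ?mulf_neq0 //.
  apply/eqP => a0; move/matrixP/(_ 0 0): ul1; rewrite mxE -/a a0 /horner_eval horner0.
  by rewrite !mxE eqxx => /esym/eqP; rewrite oner_eq0.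
rewrite hornerM mulf_eq0 negb_or => /andP[at0 /dP[L [U [tL tU LU]]]].
set b := a.[t] in at0 *.
pose r := map_mx (horner_eval t) ur; pose c := map_mx (horner_eval t) dl.
exists (block_mx 1%:M 0 (b^-1 *: c) (b^-1 *: L)), (block_mx b%:M r 0 U); split.
- rewrite is_trig_block_mx // eqxx scalar_mx_is_trig /=.
  by apply/is_trig_mxP => i j ij; rewrite mxE (is_trig_mxP tL) ?mulr0.
- rewrite /upper_triangular tr_block_mx trmx0 tr_scalar_mx is_trig_block_mx // eqxx.
  by rewrite scalar_mx_is_trig.
- rewrite map_block_mx mulmx_block !mul1mx !mul0mx !mulmx0 !addr0.
  congr block_mx.
  + by apply/matrixP => i j; rewrite !ord1 mxE [RHS]mxE eqxx mulr1n.
  + by rewrite mul_mx_scalar scalerA divff ?scale1r.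
  + rewrite -!scalemxAl -scalerDr -LU raddfB /= map_mxM map_mxZ /= addrC subrK.
    by rewrite scalerA mulVf ?scale1r.
Qed.

End Triangular.

Section SLGeometry.
Variables (F : numFieldType) (n : nat).
Local Notation N := n.+1.
Local Notation reg := (regular_fun (@SL_coord F N)).
Implicit Types g h u b : SL F N.

Lemma SLval_inj : injective (@SLval F N).
Proof. exact: val_inj. Qed.

Lemma regular_entry i j : reg (fun g => SLval g i j).
Proof.
apply: regular_ext (regular_coord _ (mxvec_index i j)) => g.
by rewrite /SL_coord mxvecE.
Qed.

Lemma regular_comp_SL (hT : Type) k (ch : hT -> 'I_k -> F) (c : hT -> SL F N) f :
  (forall i j, regular_fun ch (fun x => SLval (c x) i j)) ->
  reg f -> regular_fun ch (f \o c).
Proof.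
move=> rc; apply: regular_comp => i.
case: (mxvec_indexP i) => a b.
by apply: regular_ext (rc a b) => x; rewrite /SL_coord mxvecE.
Qed.

Lemma regular_inv_entry i j : reg (fun g => SLval g^-1%g i j).
Proof.
apply: (@regular_ext _ _ _ _ (fun g => cofactor (SLval g) j i)).
  move=> g; rewrite /= /invmx SL_unitmx (eqP (SL_det g)) invr1 scale1r.
  by rewrite [RHS]mxE.
apply: regularM; first exact: regular_const.
apply: (@regular_ext _ _ _ _
  (fun g => \det (\matrix_(a, b) SLval g (lift j a) (lift i b)))) => [g|].
  by congr (\det _); apply/matrixP => a b; rewrite !mxE.
by apply: regular_det => a b; exact: regular_entry.
Qed.

Lemma regular_mulr_entry h i j : reg (fun g => SLval (g * h)%g i j).
Proof.
apply: (@regular_ext _ _ _ _ (fun g => \sum_k SLval g i k * SLval h k j)).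
  by move=> g; rewrite mxE.
apply: regular_sum => k _; apply: regularM; first exact: regular_entry.
exact: regular_const.
Qed.

(** Join 1 to [g] by a segment of matrices and correct the determinant by rescaling the last row.
    Along this path [f] is a polynomial divided by a power of the determinant [delta]. For generic
    parameters an LU factorization exists and [f] vanishes, so the polynomial is 0; the endpoint has
    [delta] equal to 1. *)
Lemma SL_big_cell_dense f : reg f ->
  (forall u b, lower_triangular (SLval u) -> upper_triangular (SLval b) ->
     f (u * b)%g = 0) ->
  forall g, f g = 0.
Proof.
move=> fr f0 g.
pose M : 'M[{poly F}]_N :=
  \matrix_(i, j) ((1 - 'X) * (i == j)%:R + 'X * (SLval g i j)%:P).
have ME t i j : (M i j).[t] = (1 - t) * (i == j)%:R + t * SLval g i j.
  by rewrite mxE !hornerE; case: eqP; rewrite !hornerE.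
have M0 : map_mx (horner_eval 0) M = 1%:M.
  apply/matrixP => i j; rewrite mxE /horner_eval ME [RHS]mxE.
  by rewrite subr0 mul1r mul0r addr0.
have M1 : map_mx (horner_eval 1) M = SLval g.
  apply/matrixP => i j; rewrite mxE /horner_eval ME.
  by rewrite subrr mul0r mul1r add0r.
have detM t : (\det M).[t] = \det (map_mx (horner_eval t) M).
  by rewrite det_map_mx.
set delta := \det M in detM.
have [lu lu0 luP] := generic_LU M0.
pose E t : 'rV[F]_N := \row_j (if j == ord_max then (delta.[t])^-1 else 1).
have prodE t : \prod_j E t 0 j = (delta.[t])^-1.
  rewrite (bigD1 ord_max) //= mxE eqxx big1 ?mulr1 // => j jm.
  by rewrite mxE (negPf jm).
(* Where [delta] vanishes the path takes the default value 1; only parameters with nonzero [delta]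
   are ever used. *)
pose c t : SL F N :=
  insubd (SLone F N) (diag_mx (E t) *m map_mx (horner_eval t) M).
have cE t : delta.[t] != 0 -> SLval (c t) = diag_mx (E t) *m map_mx (horner_eval t) M.
  move=> dt; rewrite /c -[LHS]/(\val (insubd _ _)) insubdK //.
  by rewrite -topredE /= det_mulmx det_diag prodE -detM mulVf.
have c1 : c 1 = g.
  have d1 : delta.[1] = 1 by rewrite detM M1 (eqP (SL_det g)).
  apply: SLval_inj; rewrite cE ?d1 ?oner_eq0 // M1.
  have -> : E 1 = const_mx 1.
    by apply/matrixP => i j; rewrite !mxE d1 invr1 if_same.
  by rewrite diag_const_mx mul1mx.
pose P (phi : F -> F) := exists q e, forall t, delta.[t] != 0 ->
  delta.[t] ^+ e * phi t = q.[t].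
have [q [e qe]] : P (f \o c).
  apply: regular_ind fr.
  - by move=> h h' hh [q [e qe]]; exists q, e => t /qe; rewrite hh.
  - by move=> a; exists a%:P, 0%N => t _; rewrite hornerC mul1r.
  - move=> h h' [q [e qe]] [q' [e' qe']].
    exists (delta ^+ e' * q + delta ^+ e * q'), (e + e')%N => t dt.
    by rewrite !hornerE -qe // -qe' // exprD; ring.
  - move=> h h' [q [e qe]] [q' [e' qe']].
    exists (q * q'), (e + e')%N => t dt.
    by rewrite hornerM -qe // -qe' // exprD mulrACA.
  - move=> k; case: (mxvec_indexP k) => i j.
    exists (if i == ord_max then M i j else delta * M i j), 1%N => t dt.
    rewrite /SL_coord mxvecE cE // mul_diag_mx mxE [X in _ * (X * _)]mxE [X in _ * (_ * X)]mxE.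
    by case: eqP => _; rewrite ?hornerM // ?mul1r // mulrA divff // mul1r.
have q0 : q = 0.
  apply: (@poly_eq0_cofinite _ q (delta * lu)).
    rewrite mulf_neq0 //; apply/eqP => d0; have := detM 1.
    by rewrite d0 M1 (eqP (SL_det g)) horner0 => /esym/eqP; rewrite oner_eq0.
  move=> t; rewrite hornerM mulf_eq0 negb_or => /andP[dt /luP[L [U [tL tU LU]]]].
  rewrite -qe //=; apply/eqP; rewrite mulf_eq0; apply/orP; right.
  have tD (v : 'rV[F]_N) : is_trig_mx (diag_mx v) by exact: diag_mx_is_trig.
  have uD (v : 'rV[F]_N) : upper_triangular (diag_mx v).
    by rewrite /upper_triangular tr_diag_mx.
  pose L1 := diag_mx (E t) *m L.
  have tL1 : is_trig_mx L1 by exact: trig_mulmx.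
  have det1 : \det L1 * \det U = 1.
    by rewrite -det_mulmx -mulmxA -LU -cE // (eqP (SL_det _)).
  have L10 : \det L1 != 0.
    by apply/eqP => L10; move/eqP: det1; rewrite L10 mul0r eq_sym oner_eq0.
  (* The LU factors need not have determinant 1; this diagonal matrix moves the determinant of [L1]
     to the other factor. *)
  pose K (x : F) : 'rV[F]_N := \row_j (if j == ord_max then x else 1).
  have detK x : \det (diag_mx (K x)) = x.
    rewrite det_diag (bigD1 ord_max) //= mxE eqxx big1 ?mulr1 // => j jm.
    by rewrite mxE (negPf jm).
  have KK : diag_mx (K (\det L1)^-1) *m diag_mx (K (\det L1)) = 1%:M.
    rewrite mulmx_diag; apply/matrixP => i j; rewrite !mxE.
    by case: (i == ord_max); rewrite ?mulVf ?mulr1.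
  have d1 : \det (L1 *m diag_mx (K (\det L1)^-1)) == 1.
    by rewrite det_mulmx detK divff.
  have d2 : \det (diag_mx (K (\det L1)) *m U) == 1 by rewrite det_mulmx detK det1.
  have -> : c t = (MkSL d1 * MkSL d2)%g.
    apply: SLval_inj; rewrite cE // LU mulmxA.
    by rewrite -[RHS]mulmxA (mulmxA _ _ U) KK mul1mx.
  by rewrite f0 //=; [exact: trig_mulmx|exact: upper_mulmx].
by have := qe 1; rewrite detM M1 (eqP (SL_det g)) oner_eq0 q0 horner0 expr1n mul1r /= c1 => ->.
Qed.

End SLGeometry.

Section ClosedField.
Variables (F : numClosedFieldType) (n : nat).
Local Notation N := n.+1.
Local Notation regH := (regular_fun (@SL_coord F N)).
Local Notation regG := (regular_fun (@SLxSL_coord F N)).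
Implicit Types u b : SL F N.

Lemma SL_mulE (g h : SL F N) : SLval (g * h)%g = SLval g *m SLval h. Proof. by []. Qed.

Lemma SL_lower_inv (h : SL F N) : lower_triangular (SLval h) -> lower_triangular (SLval h^-1%g).
Proof. by apply: trig_inv; rewrite -SL_mulE mulgV. Qed.

Lemma SL_upper_inv (h : SL F N) : upper_triangular (SLval h) -> upper_triangular (SLval h^-1%g).
Proof. by apply: trig_inv; rewrite -trmx_mul -SL_mulE mulVg; exact: trmx1. Qed.

Lemma SL_big_cell_dense_rev f : regH f ->
  (forall u b, lower_triangular (SLval u) -> upper_triangular (SLval b) ->
     f (b * u)%g = 0) ->
  forall g, f g = 0.
Proof.
move=> fr f0 g; rewrite -(invgK g).
apply: (@SL_big_cell_dense F n (f \o (fun g => g^-1%g))) => [|u b uL bU].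
  by apply: regular_comp_SL fr => i j; exact: regular_inv_entry.
rewrite /= invgM; apply: f0; [exact: SL_lower_inv|exact: SL_upper_inv].
Qed.

Lemma regular_entry1 i j : regG (fun p => SLval p.1 i j).
Proof.
apply: regular_ext (regular_coord _ (lshift (N * N) (mxvec_index i j))) => g.
by rewrite /SLxSL_coord row_mxEl mxvecE.
Qed.

Lemma regular_entry2 i j : regG (fun p => SLval p.2 i j).
Proof.
apply: regular_ext (regular_coord _ (rshift (N * N) (mxvec_index i j))) => g.
by rewrite /SLxSL_coord row_mxEr mxvecE.
Qed.

Lemma regular_fst f : regH f -> regG (f \o fst).
Proof. by apply: regular_comp_SL => i j; exact: regular_entry1. Qed.

Lemma regular_snd f : regH f -> regG (f \o snd).
Proof. by apply: regular_comp_SL => i j; exact: regular_entry2. Qed.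

Lemma regular_ind_SLxSL (T : Type) (P : (T -> F) -> Prop) (c : T -> SL F N * SL F N) f :
  (forall h h', h =1 h' -> P h -> P h') -> (forall a, P (fun=> a)) ->
  (forall h h', P h -> P h' -> P (fun t => h t + h' t)) ->
  (forall h h', P h -> P h' -> P (fun t => h t * h' t)) ->
  (forall i j, P (fun t => SLval (c t).1 i j)) ->
  (forall i j, P (fun t => SLval (c t).2 i j)) -> regG f -> P (f \o c).
Proof.
move=> Pext Pc PD PM P1 P2; apply: regular_ind => // k.
case: (split_ordP k) => k' ->; case: (mxvec_indexP k') => i j.
  by apply: Pext (P1 i j) => t; rewrite /SLxSL_coord row_mxEl mxvecE.
by apply: Pext (P2 i j) => t; rewrite /SLxSL_coord row_mxEr mxvecE.
Qed.

Lemma regular_comp_SLxSL (hT : Type) k (ch : hT -> 'I_k -> F)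
    (c : hT -> SL F N * SL F N) f :
  (forall i j, regular_fun ch (fun x => SLval (c x).1 i j)) ->
  (forall i j, regular_fun ch (fun x => SLval (c x).2 i j)) ->
  regG f -> regular_fun ch (f \o c).
Proof.
move=> r1 r2; apply: regular_ind_SLxSL => //.
- exact: regular_ext.
- exact: regular_const.
- exact: regularD.
- exact: regularM.
Qed.

Lemma regular_pairr f y : regG f -> regH (fun x => f (x, y)).
Proof.
move=> fr; apply: (@regular_comp_SLxSL _ _ _ (fun x => (x, y))) fr => i j.
  exact: regular_entry.
exact: regular_const.
Qed.

Lemma regular_pairl f x : regG f -> regH (fun y => f (x, y)).
Proof.
move=> fr; apply: (@regular_comp_SLxSL _ _ _ (fun y => (x, y))) fr => i j.
  exact: regular_const.
exact: regular_entry.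
Qed.

Lemma SLxSL_big_cell_dense f : regG f ->
  (forall u b u' b', lower_triangular (SLval u) -> upper_triangular (SLval b) ->
    lower_triangular (SLval u') -> upper_triangular (SLval b') ->
    f ((u * b)%g, (b' * u')%g) = 0) ->
  forall g, f g = 0.
Proof.
move=> fr f0 [x y].
apply: (SL_big_cell_dense_rev (regular_pairl x fr)) => u' b' uL' bU'.
apply: (SL_big_cell_dense (regular_pairr _ fr)) => u b uL bU.
exact: f0.
Qed.

(** This is the sphericity of $H$ in $G$: $B^-\times B$ has a dense orbit on $G/H$. Write $y=zx$;
    for $z=bu$ in the reversed big cell, $(x,bux)=(u^{-1}h,bh)$ with $h=ux$. *)
Lemma SLxSL_diagonal_dense f : regG f ->
  (forall u b h, lower_triangular (SLval u) -> upper_triangular (SLval b) ->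
    f ((u * h)%g, (b * h)%g) = 0) ->
  forall g, f g = 0.
Proof.
move=> fr f0 [x y].
have fr' : regH (fun z => f (x, (z * x)%g)).
  apply: (@regular_comp_SLxSL _ _ _ (fun z => (x, (z * x)%g))) fr => i j.
    exact: regular_const.
  exact: regular_mulr_entry.
rewrite -(mulgVK x y); apply: (SL_big_cell_dense_rev fr') => u b uL bU.
have := f0 u^-1%g b (u * x)%g; rewrite mulgA mulVg mul1g mulgA; apply=> //.
exact: SL_lower_inv.
Qed.

End ClosedField.

(** * Contraction of a Borel subgroup to the torus *)

Section Contraction.
Variables (F : numClosedFieldType) (n : nat).
Local Notation N := n.+1.
Implicit Types (u b : SL F N) (lam : 'rV[int]_n).

Lemma scaled_diag_SL (w : 'I_N -> F) : (forall i, w i != 0) ->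
  exists2 t : SL F N, SLval t = diag_mx (\row_i (n.+1.-root (\prod_j w j)^-1 * w i)) &
    forall i, SLval t i i != 0.
Proof.
move=> w0; have pw0 : \prod_j w j != 0 by apply/prodf_neq0.
set a := n.+1.-root _; have aN : a ^+ N = (\prod_j w j)^-1 by rewrite rootCK.
have dt : \det (diag_mx (\row_i (a * w i))) == 1.
  rewrite det_diag; under eq_bigr do rewrite mxE.
  by rewrite big_split /= prodr_const card_ord aN mulVf.
exists (MkSL dt) => // i; rewrite !mxE eqxx mulr1n mulf_neq0 //.
by rewrite rootC_eq0 // invr_eq0.
Qed.

(** [tau s] is $\mathrm{diag}(s^{w_i})$ times a scalar that brings the determinant to 1 and cancels
    under conjugation. The entry at $(i,j)$ is multiplied by $s^{w_i-w_j}$, a positive power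
    wherever an off-diagonal entry is nonzero, so only the diagonal survives at 0. *)
Lemma torus_contraction (w : 'I_N -> nat) :
  exists2 tau : F -> SL F N,
    forall s, s != 0 -> is_diag_mx (SLval (tau s)) /\ forall i, SLval (tau s) i i != 0 &
    forall u, \prod_i SLval u i i = 1 ->
      (forall i j, i != j -> SLval u i j != 0 -> (w j < w i)%N) ->
      exists2 c : F -> SL F N,
        (forall i j, exists q : {poly F}, forall s, SLval (c s) i j = q.[s]) /\
        (forall s, s != 0 -> c s = (tau s * u * (tau s)^-1)%g) &
        SLval (c 0) = diag_mx (\row_i SLval u i i).
Proof.
pose t s : SL F N := if pselect (s != 0) is left s0
  then s2val (cid2 (@scaled_diag_SL (fun i => s ^+ w i) (fun i => expf_neq0 _ s0)))
  else 1%g.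
have tE s : s != 0 -> exists2 a, a != 0 & SLval (t s) = diag_mx (\row_i (a * s ^+ w i)).
  move=> s0; rewrite /t; case: pselect => // s0'.
  case: cid2 => /= x xE _; exists (n.+1.-root (\prod_j s ^+ w j)^-1) => //.
  by rewrite rootC_eq0 // invr_eq0; apply/prodf_neq0 => j _; exact: expf_neq0.
exists t => [s s0|u u1 uw].
  have [a a0 ->] := tE s s0; split; first exact: diag_mx_is_diag.
  by move=> i; rewrite !mxE eqxx mulr1n mulf_neq0 // expf_neq0.
have du0 : \det (diag_mx (\row_i SLval u i i)) == 1.
  by rewrite det_diag -[X in _ == X]u1; apply/eqP/eq_bigr => i _; rewrite mxE.
exists (fun s => if s == 0 then MkSL du0 else (t s * u * (t s)^-1)%g); last first.
  by rewrite eqxx.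
split=> [i j|s s0]; last by rewrite (negPf s0).
exists (SLval u i j *: 'X^(w i - w j)) => s; rewrite hornerZ hornerXn.
have [->|s0] := eqVneq s 0.
  rewrite !mxE; have [->|ij] := eqVneq i j; first by rewrite subnn mulr1.
  have [->|uij] := eqVneq (SLval u i j) 0; first by rewrite mul0r.
  by rewrite expr0n subn_eq0 leqNgt (uw i j) ?mulr0.
have [a a0 tsE] := tE s s0; set c := (_ * _)%g.
have : SLval c *m SLval (t s) = SLval (t s) *m SLval u.
  by rewrite -!SL_mulE /c mulgVK.
rewrite tsE mul_diag_mx mul_mx_diag => /matrixP/(_ i j).
rewrite !mxE => /eqP E; have as0 : a * s ^+ w j != 0 by rewrite mulf_neq0 ?expf_neq0.
apply: (mulIf as0); rewrite (eqP E).
have [->|uij] := eqVneq (SLval u i j) 0; first by rewrite mulr0 !mul0r.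
have wij : (w j <= w i)%N by have [->//|/uw] := eqVneq i j; move=> /(_ uij)/ltnW.
rewrite -{1}(subnK wij) exprD; ring.
Qed.

Definition upper_SL u : Prop := upper_triangular (SLval u).
Definition lower_SL u : Prop := lower_triangular (SLval u).

Definition wt_SL lam u : F := wt_eval lam (SLval u).

Lemma diag_upper (A : 'M[F]_N) : is_diag_mx A -> upper_triangular A.
Proof.
move=> /is_diag_mxP dA; apply/upper_triangularP => i j ij; apply: dA.
by rewrite neq_ltn ij orbT.
Qed.

Lemma SL_diag_prod u : lower_SL u \/ upper_SL u -> \prod_i SLval u i i = 1.
Proof.
case=> ut; rewrite -[RHS](eqP (SL_det u)); first by rewrite (det_trig ut).
by rewrite -det_tr (det_trig ut); apply: eq_bigr => i _; rewrite mxE.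
Qed.

Lemma SL_diag_neq0 u i : lower_SL u \/ upper_SL u -> SLval u i i != 0.
Proof.
move=> /SL_diag_prod; rewrite (bigD1 i) //= => D; apply/eqP => u0.
by move/eqP: D; rewrite u0 mul0r eq_sym oner_eq0.
Qed.

Lemma lower_SL1 : lower_SL 1%g.
Proof. exact: scalar_mx_is_trig. Qed.

Lemma upper_SL1 : upper_SL 1%g.
Proof. by apply: diag_upper; exact: scalar_mx_is_diag. Qed.

Lemma lower_SLM u u' : lower_SL u -> lower_SL u' -> lower_SL (u * u')%g.
Proof. exact: trig_mulmx. Qed.

Lemma upper_SLM u u' : upper_SL u -> upper_SL u' -> upper_SL (u * u')%g.
Proof. exact: upper_mulmx. Qed.

Lemma wt_SL_lowerM lam u u' : lower_SL u -> lower_SL u' ->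
  wt_SL lam (u * u')%g = wt_SL lam u * wt_SL lam u'.
Proof. by move=> uL uL'; apply: wt_evalM => j; exact: trig_mulmx_diag. Qed.

Lemma wt_SL_upperM lam u u' : upper_SL u -> upper_SL u' ->
  wt_SL lam (u * u')%g = wt_SL lam u * wt_SL lam u'.
Proof. by move=> uU uU'; apply: wt_evalM => j; exact: upper_mulmx_diag. Qed.

Lemma wt_SL1 lam : wt_SL lam 1%g = 1.
Proof. exact: wt_eval1. Qed.

(** The weights $w_i=i$ contract the lower triangular group and $w_i=N-i$ the upper one. *)
Lemma Borel_contraction (B : SL F N -> Prop) :
  B = lower_SL \/ B = upper_SL ->
  exists2 tau : F -> SL F N,
    forall s, s != 0 -> is_diag_mx (SLval (tau s)) /\ forall i, SLval (tau s) i i != 0 &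
    forall u, B u -> exists2 c : F -> SL F N,
        (forall i j, exists q : {poly F}, forall s, SLval (c s) i j = q.[s]) /\
        (forall s, s != 0 -> c s = (tau s * u * (tau s)^-1)%g) &
        is_diag_mx (SLval (c 0)) /\ forall i, SLval (c 0) i i = SLval u i i.
Proof.
have diagE u (v : SL F N) : SLval v = diag_mx (\row_i SLval u i i) ->
    is_diag_mx (SLval v) /\ forall i, SLval v i i = SLval u i i.
  by move=> ->; split=> [|i]; [exact: diag_mx_is_diag|rewrite !mxE eqxx].
case=> ->.
- have [tau tauD tauC] := torus_contraction (fun i => val i).
  exists tau => // u uL; have [||c cP /diagE c0] := tauC u; last by exists c.
    by apply: SL_diag_prod; left.
  move=> i j ij; apply: contraNT; rewrite -leqNgt => ij'; apply/eqP.
  by apply: (is_trig_mxP uL); rewrite ltn_neqAle ij' andbT.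
- have [tau tauD tauC] := torus_contraction (fun i => N - val i)%N.
  exists tau => // u uL; have [||c cP /diagE c0] := tauC u; last by exists c.
    by apply: SL_diag_prod; right.
  move=> i j ij; apply: contraNT; rewrite -leqNgt => ij'; apply/eqP.
  apply: (upper_triangularP _ uL); rewrite ltn_neqAle eq_sym ij /=.
  move: (ltn_ord i) (ltn_ord j) ij' => /=; lia.
Qed.

Lemma big_cell_SL lam : big_cell (@SL_coord F N) upper_SL lower_SL (wt_SL lam).
Proof.
split.
- exact: lower_SL1.
- exact: lower_SLM.
- exact: wt_SL_lowerM.
- exact: wt_SL1.
- move=> f fr f0; apply: (SL_big_cell_dense fr); exact: f0.
have [tau tauD tauC] := Borel_contraction (or_introl erefl).
exists tau => [s s0|u uL].
  by have [tD t0] := tauD s s0; split; [exact: diag_upper|exact: wt_eval_neq0].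
have [c [cq cE] [c0D c0E]] := tauC u uL.
exists (c 0) => [|f fr]; first by split; [exact: diag_upper|exact: wt_eval_diag].
pose P (phi : F -> F) := exists q : {poly F}, forall s, phi s = q.[s].
have [q qE] : P (f \o c); last first.
  by exists q => [s s0|]; rewrite -?cE // -qE.
apply: regular_ind fr.
- by move=> h h' hh [q qE]; exists q => s; rewrite -hh.
- by move=> a; exists a%:P => s; rewrite hornerC.
- by move=> h h' [q qE] [q' qE']; exists (q + q') => s; rewrite hornerD -qE -qE'.
- by move=> h h' [q qE] [q' qE']; exists (q * q') => s; rewrite hornerM -qE -qE'.
- move=> k; case: (mxvec_indexP k) => i j; have [q qE] := cq i j.
  by exists q => s; rewrite /SL_coord mxvecE.
Qed.

Definition SLxSL_pos (p : SL F N * SL F N) : Prop := upper_SL p.1 /\ lower_SL p.2.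
Definition SLxSL_neg (p : SL F N * SL F N) : Prop := lower_SL p.1 /\ upper_SL p.2.
Definition wt_SLxSL (lam : 'rV[int]_n * 'rV[int]_n) (p : SL F N * SL F N) : F :=
  wt_SL lam.1 p.1 * wt_SL lam.2 p.2.

Lemma big_cell_SLxSL (lam : 'rV[int]_n * 'rV[int]_n) :
  big_cell (@SLxSL_coord F N) SLxSL_pos SLxSL_neg (wt_SLxSL lam).
Proof.
split.
- by split; [exact: lower_SL1|exact: upper_SL1].
- by move=> [u u'] [b b'] [/= ? ?] [/= ? ?]; split; [exact: lower_SLM|exact: upper_SLM].
- move=> [u u'] [b b'] [/= ? ?] [/= ? ?]; rewrite /wt_SLxSL /=.
  by rewrite wt_SL_lowerM // wt_SL_upperM // mulrACA.
- by rewrite /wt_SLxSL !wt_SL1 mulr1.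
- move=> f fr f0; apply: (SLxSL_big_cell_dense fr) => u b u' b' uL bU uL' bU'.
  exact: (f0 (u, b') (b, u')).
have [tau tauD tauC] := Borel_contraction (or_introl erefl).
have [tau' tauD' tauC'] := Borel_contraction (or_intror erefl).
exists (fun s => (tau s, tau' s)) => [s s0|[u u'] [/= uL uU]].
  have [tD t0] := tauD s s0; have [tD' t0'] := tauD' s s0; split.
    by split; [exact: diag_upper|exact: is_diag_mx_is_trig].
  by rewrite mulf_neq0 //; exact: wt_eval_neq0.
have [c [cq cE] [c0D c0E]] := tauC u uL.
have [c' [cq' cE'] [c0D' c0E']] := tauC' u' uU.
exists (c 0, c' 0) => [|f fr].
  split; first by split; [exact: diag_upper|exact: is_diag_mx_is_trig].
  by congr (_ * _); exact: wt_eval_diag.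
pose P (phi : F -> F) := exists q : {poly F}, forall s, phi s = q.[s].
have [q qE] : P (f \o (fun s => (c s, c' s))); last first.
  exists q => [s s0|]; rewrite -qE //=.
  by rewrite cE // cE'.
apply: regular_ind_SLxSL fr.
- by move=> h h' hh [q qE]; exists q => s; rewrite -hh.
- by move=> a; exists a%:P => s; rewrite hornerC.
- by move=> h h' [q qE] [q' qE']; exists (q + q') => s; rewrite hornerD -qE -qE'.
- by move=> h h' [q qE] [q' qE']; exists (q * q') => s; rewrite hornerM -qE -qE'.
- exact: cq.
- exact: cq'.
Qed.

End Contraction.

(** * Realization of positive definite kernels *)

Section Realization.
Variable F : numClosedFieldType.

Definition adjmx m n (A : 'M[F]_(m, n)) : 'M[F]_(n, m) := (map_mx Num.conj A)^T.

Lemma adjmxM m n p (A : 'M[F]_(m, n)) (B : 'M[F]_(n, p)) :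
  adjmx (A *m B) = adjmx B *m adjmx A.
Proof. by rewrite /adjmx map_mxM trmx_mul. Qed.

Lemma adjmx_norm0 m (x : 'cV[F]_m) : adjmx x *m x = 0 -> x = 0.
Proof.
move/matrixP/(_ 0 0); rewrite !mxE => /eqP; rewrite psumr_eq0 => [/allP x0|i _].
  apply/matrixP => i j; rewrite ord1 [RHS]mxE; apply/eqP.
  have := x0 i (mem_index_enum _); rewrite /= !mxE mulrC -normCK sqrf_eq0.
  by rewrite normr_eq0.
by rewrite !mxE mulrC -normCK exprn_ge0.
Qed.

(** If the Gram matrix kills $x$, then $Dx$ has norm 0, so $Dx=0$ and $x=0$ by independence of the
    columns. *)
Lemma gram_unitmx m d (D : 'M[F]_(m, d)) :
  row_free D^T -> adjmx D *m D \in unitmx.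
Proof.
move=> Dfree; rewrite -unitmx_tr -row_free_unit -kermx_eq0; apply/rowV0P => x /sub_kermxP.
move=> xG; apply: (can_inj (@trmxK _ _ _)); rewrite trmx0.
have: D *m x^T = 0.
  apply: adjmx_norm0; rewrite adjmxM -mulmxA (mulmxA (adjmx D)).
  by move/(congr1 trmx): xG; rewrite trmx_mul trmxK trmx0 => ->; rewrite mulmx0.
move/(congr1 trmx); rewrite trmx_mul trmxK trmx0 -(mul0mx _ D^T).
by move/(row_free_inj Dfree) => ->; rewrite trmx0.
Qed.

(* The Hermitian form on the span of the vectors [q _ h] is nondegenerate
   because it is positive definite; this replaces complete reducibility. *)
Lemma positive_realization (gT : groupType) m (coord : gT -> 'I_m -> F)
    (st : gT -> gT) (T : finType) (q : T -> gT -> F) (Phi : gT -> F) :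
  (forall f h, regular_fun coord f -> regular_fun coord (fun g => f (g * h)%g)) ->
  involutive st -> (forall t, regular_fun coord (q t)) ->
  (forall g h, Phi (g * h)%g = \sum_t (q t (st g))^* * q t h) ->
  exists d (rho : gT -> 'M[F]_d) (xi : 'rV_d) (v : 'cV_d)
      (c : T -> 'cV_d) (e : T -> 'rV_d),
    [/\ rational_rep coord rho, cyclic_col rho v /\ cyclic_row rho xi,
      (forall g, xi *m (rho g *m v) = (Phi g)%:M),
      (forall t g, xi *m (rho g *m c t) = ((q t (st g))^*)%:M)
      & (forall t h, e t *m (rho h *m v) = (q t h)%:M)].
Proof.
move=> reg_tr stK q_reg PhiE.
pose qc h : 'cV[F]_#|T| := \col_i q (enum_val i) h.
have [d [hs [Bfree Bspan]]] := extract_row_base (fun h => (qc h)^T).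
pose D := (\matrix_l (qc (hs l))^T)^T.
have Dfree : row_free D^T by rewrite trmxK.
have Gu := gram_unitmx Dfree; have [G GE] : exists G, G = adjmx D *m D by exists (adjmx D *m D).
rewrite -GE in Gu.
have Dinj (x y : 'cV_d) : D *m x = D *m y -> x = y.
  move/(congr1 trmx); rewrite !trmx_mul => /(row_free_inj Dfree).
  exact: (can_inj (@trmxK _ _ _)).
have /choice[Q QE] h : exists Q : 'cV_d, qc h = D *m Q.
  have /submxP[x xE] := Bspan h; exists x^T.
  by apply: (can_inj (@trmxK _ _ _)); rewrite trmx_mul !trmxK.
have Qhs l : Q (hs l) = delta_mx l 0.
  apply: Dinj; rewrite -QE -colE.
  by apply: (can_inj (@trmxK _ _ _)); rewrite tr_col trmxK rowK.
(* [Q h] is the coordinate vector of [qc h] in the chosen basis and [P g] the functional dual to it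
   under the form. Their pairing depends only on the product of the two group elements, which makes
   translation well defined. *)
pose P g := adjmx (Q (st g)) *m G.
have PQ x y : P x *m Q y = (Phi (x * y)%g)%:M.
  rewrite PhiE /P GE -!mulmxA -QE mulmxA -adjmxM -QE.
  apply/matrixP => i j; rewrite !ord1 !mxE eqxx mulr1n.
  rewrite [RHS](reindex (@enum_val T T)) /=; last exact/onW_bij/enum_val_bij.
  by apply: eq_bigr => k _; rewrite !mxE.
have Phs l : P (st (hs l)) = row l G.
  rewrite /P stK Qhs rowE; congr (_ *m _); apply/matrixP => i j.
  by rewrite !mxE ord1 eqxx andbT rmorph_nat.
have Pinj k (A B : 'M_(d, k)) : (forall x, P x *m A = P x *m B) -> A = B.
  move=> AB; apply: (can_inj (mulKmx Gu)); apply/row_matrixP => l.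
  by rewrite !row_mul -!Phs AB.
(* Left translation: the [l]-th basis vector [Q (hs l)] goes to [Q (h * hs l)]. *)
pose rho h : 'M_d := \matrix_(i, l) Q (h * hs l)%g i 0.
have Prho x h : P x *m rho h = P (x * h)%g.
  apply/matrixP => i l; rewrite ord1.
  have -> : P (x * h)%g 0 l = (P (x * h)%g *m Q (hs l)) 0 0 by rewrite Qhs -colE [RHS]mxE.
  by rewrite PQ -mulgA -PQ mxE [RHS]mxE; apply: eq_bigr => k _; rewrite [X in _ * X = _]mxE.
have rhoQ h g : rho h *m Q g = Q (h * g)%g.
  by apply: Pinj => x; rewrite mulmxA Prho !PQ mulgA.
have Qreg i h : regular_fun coord (fun g => Q (g * h)%g i 0).
  apply: (reg_tr (fun g => Q g i 0)).
  apply: (@regular_ext _ _ _ _ (fun g => \sum_k (invmx G *m adjmx D) i k * q (enum_val k) g)).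
    move=> g; have -> : Q g = (invmx G *m adjmx D) *m qc g.
      by rewrite QE -!mulmxA (mulmxA (adjmx D)) -GE mulKmx.
    by rewrite [RHS]mxE; apply: eq_bigr => k _; congr (_ * _); rewrite mxE.
  apply: regular_sum => k _; apply: regularM => //; exact: regular_const.
exists d, rho, (P 1%g), (Q 1%g).
exists (fun t => col (enum_rank t) (invmx G *m adjmx D)), (fun t => row (enum_rank t) D).
split.
- split=> [|g h|i l].
  + by apply: Pinj => x; rewrite Prho mulg1 mulmx1.
  + by apply: Pinj => x; rewrite mulmxA !Prho mulgA.
  + by apply: regular_ext (Qreg i (hs l)) => g; rewrite mxE.
- split=> [eta eta0|x x0].
    apply/matrixP => i l; rewrite ord1 [RHS]mxE.
    have := congr1 (fun A : 'M_1 => A 0 0) (eta0 (hs l)).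
    by rewrite /= rhoQ mulg1 Qhs -colE !mxE.
  by apply: Pinj => g; rewrite -(mul1g g) -Prho -mulmxA x0 mulmx0.
- by move=> g; rewrite rhoQ PQ mul1g mulg1.
- move=> t g; rewrite mulmxA Prho mul1g colE mulmxA /P -!mulmxA mulKVmx //.
  rewrite mulmxA -adjmxM -QE -colE; apply/matrixP => i j.
  by rewrite !ord1 !mxE enum_rankK eqxx.
- move=> t h; rewrite rhoQ mulg1 rowE -mulmxA -QE -rowE.
  by apply/matrixP => i j; rewrite !ord1 !mxE enum_rankK eqxx.
Qed.

End Realization.

(** * Minors *)

Section Minors.
Variable F : comRingType.

(** Multilinearity in the rows gives a sum over all maps; those that are not injective contribute
    determinants with repeated rows. *)
Lemma det_mulmx_expand i N (A : 'M[F]_(i, N)) (B : 'M[F]_(N, i)) :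
  \det (A *m B) = \sum_(S : {ffun 'I_i -> 'I_N})
    (\prod_a A a (S a)) * \det (\matrix_(a, b) B (S a) b).
Proof.
transitivity (\sum_(s : 'S_i) \sum_(S : {ffun 'I_i -> 'I_N})
    (\prod_a A a (S a)) * ((-1) ^+ s * \prod_a B (S a) (s a))).
  apply: eq_bigr => s _; under eq_bigr do rewrite mxE.
  rewrite bigA_distr_bigA big_distrr /=; apply: eq_bigr => S _.
  by rewrite big_split mulrCA.
rewrite exchange_big; apply: eq_bigr => S _; rewrite -big_distrr /=.
congr (_ * _); apply: eq_bigr => s _; congr (_ * _).
by apply: eq_bigr => a _; rewrite mxE.
Qed.

(* The factor [i`!] appears because [S] runs over all maps, not over subsets. *)
Lemma Cauchy_Binet i N (A : 'M[F]_(i, N)) (B : 'M[F]_(N, i)) :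
  \sum_(S : {ffun 'I_i -> 'I_N})
    \det (\matrix_(a, b) A a (S b)) * \det (\matrix_(a, b) B (S a) b) =
  i`!%:R * \det (A *m B).
Proof.
under eq_bigr => S _ do rewrite big_distrl /=.
rewrite exchange_big /=.
rewrite (eq_bigr (fun=> \det (A *m B))) => [|s _].
  by rewrite sumr_const card_Sn mulr_natl.
rewrite det_mulmx_expand.
(* For each permutation [s] from the expansion of the first minor, replacing [S] by its composite
   with the inverse of [s] permutes the rows of the second minor. The two signs cancel, so every [s]
   contributes [\det (A *m B)]. *)
rewrite (reindex_inj (h := fun S : {ffun 'I_i -> 'I_N} => [ffun a => S (s^-1%g a)])) /=.
  apply: eq_bigr => S _.
  have -> : \matrix_(a, b) B ([ffun a => S (s^-1%g a)] a) b =
      row_perm s^-1%g (\matrix_(a, b) B (S a) b).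
    by apply/matrixP => a b; rewrite !mxE ffunE.
  rewrite row_permE det_mulmx det_perm odd_permV mulrACA -expr2 sqrr_sign mul1r.
  by congr (_ * _); apply: eq_bigr => a _; rewrite mxE ffunE permK.
move=> S S' /ffunP SS; apply/ffunP => a; have := SS (s a).
by rewrite !ffunE permK.
Qed.
End Minors.

(** * Leading minors and fundamental weights *)

Section LeadingMinors.
Variables (F : numClosedFieldType) (n : nat).
Local Notation N := n.+1.
Implicit Types (A B : 'M[F]_N) (u b x y : SL F N).

Definition rowsel i (S : {ffun 'I_i -> 'I_N}) A : 'M[F]_i := \matrix_(a, b) A (inord a) (S b).
Definition colsel i (S : {ffun 'I_i -> 'I_N}) A : 'M[F]_i := \matrix_(a, b) A (S a) (inord b).
Definition leading_minor i A : F := \det (\matrix_(a < i, b < i) A (inord a) (inord b)).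

Lemma leading_minorM i A B :
  i`!%:R * leading_minor i (A *m B) =
  \sum_(S : {ffun 'I_i -> 'I_N}) \det (rowsel S A) * \det (colsel S B).
Proof.
pose A' : 'M_(i, N) := \matrix_(a, j) A (inord a) j.
pose B' : 'M_(N, i) := \matrix_(j, a) B j (inord a).
have -> : leading_minor i (A *m B) = \det (A' *m B').
  congr (\det _); apply/matrixP => a b; rewrite !mxE.
  by apply: eq_bigr => j _; rewrite !mxE.
rewrite -Cauchy_Binet; apply: eq_bigr => S _.
by congr (_ * _); congr determinant; apply/matrixP => a b; rewrite !mxE.
Qed.

(** This turns the Cauchy-Binet sum into a Hermitian kernel: row minors of [A] are conjugates of
    column minors of the adjoint of [A]. *)
Lemma conj_colsel i (S : {ffun 'I_i -> 'I_N}) A :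
  (\det (colsel S (adjmx A)))^* = \det (rowsel S A).
Proof.
rewrite /adjmx -det_map_mx -det_tr; congr (\det _); apply/matrixP => a b.
by rewrite !mxE; exact: conjCK.
Qed.

Lemma conj_rowsel i (S : {ffun 'I_i -> 'I_N}) A :
  (\det (rowsel S (adjmx A)))^* = \det (colsel S A).
Proof.
rewrite /adjmx -det_map_mx -det_tr; congr (\det _); apply/matrixP => a b.
by rewrite !mxE; exact: conjCK.
Qed.

Lemma sum_ord_trunc i (G : 'I_N -> F) : (i <= N)%N ->
  (forall k : 'I_N, (i <= k)%N -> G k = 0) -> \sum_k G k = \sum_(k < i) G (inord k).
Proof.
move=> iN G0; transitivity (\sum_(0 <= k < N) G (inord k)).
  by rewrite big_mkord; apply: eq_bigr => k _; rewrite inord_val.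
rewrite (big_cat_nat (n := i)) //= big_mkord [X in _ + X]big_nat_cond.
rewrite [X in _ + X]big1 ?addr0 // => k.
by rewrite andbT => /andP[ik kN]; apply: G0; rewrite inordK.
Qed.

Lemma leading_minor_lowerM i A B : (i <= N)%N -> is_trig_mx A ->
  leading_minor i (A *m B) = leading_minor i A * leading_minor i B.
Proof.
move=> iN tA; rewrite -det_mulmx; congr (\det _); apply/matrixP => a b.
rewrite !mxE (sum_ord_trunc iN) => [|k ik].
  by apply: eq_bigr => k _; rewrite !mxE.
by rewrite (is_trig_mxP tA) ?mul0r // inordK ?(leq_trans _ ik) // (leq_trans _ iN).
Qed.

Lemma leading_minor_tr i A : leading_minor i A^T = leading_minor i A.
Proof. by rewrite -[RHS]det_tr; congr (\det _); apply/matrixP => a b; rewrite !mxE. Qed.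

Lemma leading_minor_upperM i A B : (i <= N)%N -> upper_triangular B ->
  leading_minor i (A *m B) = leading_minor i A * leading_minor i B.
Proof.
move=> iN uB; rewrite -leading_minor_tr trmx_mul leading_minor_lowerM //.
by rewrite !leading_minor_tr mulrC.
Qed.

Lemma leading_minor_lower i A : (i <= N)%N -> is_trig_mx A ->
  leading_minor i A = \prod_(j < N | (j < i)%N) A j j.
Proof.
move=> iN tA; rewrite /leading_minor det_trig; last first.
  apply/is_trig_mxP => a b ab; rewrite mxE (is_trig_mxP tA) //.
  by rewrite !inordK ?(leq_trans _ iN).
under eq_bigr do rewrite mxE.
rewrite -(big_mkord xpredT (fun k => A (inord k) (inord k))).
rewrite (big_nat_widen _ _ N) // big_mkord; apply: eq_big => // j _.
by rewrite inord_val.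
Qed.

(** Both ends are included: the empty minor for [i = 0] and the determinant for [i = n.+1] equal 1,
    in accordance with the vanishing of [omega] there. The extreme generators $(\omega_1,0)$ and
    $(0,-\omega_n)$ rely on this. *)
Lemma wt_SL_omega i u : (i <= N)%N -> lower_SL u \/ upper_SL u ->
  wt_SL (omega n i) u = leading_minor i (SLval u).
Proof.
move=> iN ut; have -> : leading_minor i (SLval u) = \prod_(j < N | (j < i)%N) SLval u j j.
  case: (ut) => [uL|uU]; first exact: leading_minor_lower.
  rewrite -leading_minor_tr leading_minor_lower //.
  by apply: eq_bigr => j _; rewrite mxE.
rewrite /wt_SL /wt_eval; case: i iN => [|i] iN.
  rewrite big1 => [|j _]; last by rewrite mxE expr0z.
  by rewrite big_pred0.
have [iN'|iN'] := ltnP i n.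
  rewrite (bigD1 (Ordinal iN')) //= mxE eqxx [X in _ * X]big1 ?mulr1 => [|j ji].
    by rewrite expr1z; apply: eq_bigl => j; rewrite ltnS.
  by rewrite mxE eqSS; move: ji; rewrite -val_eqE /= => /negPf ->; rewrite expr0z.
rewrite big1 => [|j _].
  rewrite -[LHS](SL_diag_prod ut); apply: eq_bigl => j.
  by rewrite (leq_trans (ltn_ord j)).
rewrite mxE eqSS; case: eqP => [ji|_]; last by rewrite expr0z.
by move: (ltn_ord j); rewrite ji ltnNge iN'.
Qed.

Lemma wt_SLD (lam mu : 'rV[int]_n) u : lower_SL u \/ upper_SL u ->
  wt_SL (lam + mu) u = wt_SL lam u * wt_SL mu u.
Proof.
move=> ut; rewrite /wt_SL /wt_eval -big_split; apply: eq_bigr => i _ /=.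
by rewrite mxE expfzDr //; apply/prodf_neq0 => j _; exact: SL_diag_neq0.
Qed.

Lemma wt_SL0 u : wt_SL (0 : 'rV[int]_n) u = 1.
Proof. by rewrite /wt_SL /wt_eval big1 // => i _; rewrite mxE expr0z. Qed.

Lemma wt_SLN (lam : 'rV[int]_n) u : lower_SL u \/ upper_SL u ->
  wt_SL (- lam) u = wt_SL lam u^-1%g.
Proof.
move=> ut; have w0 : wt_SL lam u != 0 by apply: wt_eval_neq0 => j; exact: SL_diag_neq0.
apply: (mulfI w0); rewrite -wt_SLD // subrr wt_SL0.
case: ut => ut.
  by rewrite -wt_SL_lowerM ?mulgV ?wt_SL1 //; exact: SL_lower_inv.
by rewrite -wt_SL_upperM ?mulgV ?wt_SL1 //; exact: SL_upper_inv.
Qed.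

Lemma SL_star_subproof u : \det (adjmx (SLval u)) == 1.
Proof. by rewrite /adjmx det_tr det_map_mx (eqP (SL_det u)) rmorph1. Qed.

Definition SL_star u : SL F N := MkSL (SL_star_subproof u).
Definition SLxSL_star (p : SL F N * SL F N) := (SL_star p.1, SL_star p.2).

Lemma SL_starK : involutive SL_star.
Proof.
by move=> u; apply: SLval_inj; apply/matrixP => i j; rewrite /= !mxE conjCK.
Qed.

Lemma SLxSL_starK : involutive SLxSL_star.
Proof. by move=> [u u']; rewrite /SLxSL_star /= !SL_starK. Qed.

Lemma SL_starV u : SLval (SL_star u)^-1%g = adjmx (SLval u^-1%g).
Proof.
apply: (can_inj (mulKmx (SL_unitmx (SL_star u)))).
rewrite -SL_mulE mulgV -[SLval (SL_star u)]/(adjmx (SLval u)) -adjmxM -SL_mulE mulVg.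
by rewrite /adjmx /= map_mx1 trmx1.
Qed.

End LeadingMinors.

(** * Branching data *)

Section BranchingData.
Variables (F : numClosedFieldType) (n : nat).
Local Notation N := n.+1.
Local Notation H := (SL F N).
Local Notation G := (SL F N * SL F N)%type.
Implicit Types (h : H) (p : G).

Definition branching_form (T1 T2 : finType) (q1 : T1 -> G -> F) (q2 : T2 -> H -> F)
    (C : T1 -> T2 -> F) p h :=
  \sum_t \sum_s C t s * ((q1 t (SLxSL_star p))^* * q2 s h).

(* [Phi] is the highest weight matrix coefficient of the G-module of highest
   weight [lam], [h_00 ^+ k] the one of the H-module of highest weight [k omega_1],
   and [branching_form] the function [(g, h) |-> xi (g A h v)] for an H-equivariant
   map [A] from the latter to the former. *)
Definition branching_data (lam : 'rV[int]_n * 'rV[int]_n) (k : nat) :=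
  exists (T1 T2 : finType) (q1 : T1 -> G -> F) (q2 : T2 -> H -> F)
    (Phi : G -> F) (C : T1 -> T2 -> F),
  [/\ (forall t, regular_fun (@SLxSL_coord F N) (q1 t)) /\
      (forall s, regular_fun (@SL_coord F N) (q2 s)),
    (forall p p', Phi (p * p')%g = \sum_t (q1 t (SLxSL_star p))^* * q1 t p'),
    (forall h h', SLval (h * h')%g 0 0 ^+ k = \sum_s (q2 s (SL_star h))^* * q2 s h'),
    [/\ forall u p, SLxSL_neg u -> Phi (u * p)%g = wt_SLxSL lam u * Phi p,
      forall b p, SLxSL_pos b -> Phi (p * b)%g = wt_SLxSL lam b * Phi p &
      Phi 1%g != 0]
    & (forall p h h', branching_form q1 q2 C (p * (h', h'))%g h =
        branching_form q1 q2 C p (h' * h)%g) /\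
      (forall h, (forall i, SLval h i 0 = 1) -> branching_form q1 q2 C 1%g h != 0)].

Lemma sum_pairM (I J : finType) (f : I -> F) (g : J -> F) :
  \sum_(ij : I * J) f ij.1 * g ij.2 = (\sum_i f i) * (\sum_j g j).
Proof. by rewrite big_distrlr pair_bigA. Qed.

Lemma wt_SLxSLD (lam mu : 'rV[int]_n * 'rV[int]_n) p :
  SLxSL_neg p \/ SLxSL_pos p ->
  wt_SLxSL (lam + mu) p = wt_SLxSL lam p * wt_SLxSL mu p.
Proof.
case: lam mu p => lam1 lam2 [mu1 mu2] [x y].
move=> pB; have xB : lower_SL x \/ upper_SL x by case: pB => -[]; [left|right].
have yB : lower_SL y \/ upper_SL y by case: pB => -[]; [right|left].
transitivity (wt_SL (lam1 + mu1) x * wt_SL (lam2 + mu2) y).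
  by [].
by rewrite (wt_SLD _ _ xB) (wt_SLD _ _ yB); exact: mulrACA.
Qed.

(** Products of coefficients are coefficients of tensor products, so the index sets multiply and the
    weights add. Nonvanishing is demanded at prescribed points, hence passes to the product. *)
Lemma branching_dataM lam mu k l : branching_data lam k -> branching_data mu l ->
  branching_data (lam + mu) (k + l).
Proof.
move=> [T1 [T2 [q1 [q2 [Phi [C [[r1 r2] PhiE phiE [Phiu Phib Phi1] [Cinv C1]]]]]]]].
move=> [S1 [S2 [p1 [p2 [Psi [D [[s1 s2] PsiE psiE [Psiu Psib Psi1] [Dinv D1]]]]]]]].
exists (T1 * S1)%type, (T2 * S2)%type.
exists (fun t p => q1 t.1 p * p1 t.2 p), (fun t h => q2 t.1 h * p2 t.2 h).
exists (fun p => Phi p * Psi p), (fun t s => C t.1 s.1 * D t.2 s.2).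
have formM p h : branching_form (fun t p => q1 t.1 p * p1 t.2 p)
    (fun t h => q2 t.1 h * p2 t.2 h) (fun t s => C t.1 s.1 * D t.2 s.2) p h =
    branching_form q1 q2 C p h * branching_form p1 p2 D p h.
  rewrite /branching_form -sum_pairM; apply: eq_bigr => t _.
  rewrite -sum_pairM; apply: eq_bigr => s _.
  by rewrite rmorphM /=; ring.
split.
- by split=> t; exact: regularM.
- move=> p p'; rewrite PhiE PsiE -sum_pairM; apply: eq_bigr => t _.
  by rewrite rmorphM mulrACA.
- move=> h h'; rewrite exprD phiE psiE -sum_pairM; apply: eq_bigr => t _.
  by rewrite rmorphM mulrACA.
- split=> [u p uB|b p bB|]; last by rewrite mulf_neq0.
    by rewrite (Phiu _ _ uB) (Psiu _ _ uB) (wt_SLxSLD _ _ (or_introl uB)) mulrACA.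
  by rewrite (Phib _ _ bB) (Psib _ _ bB) (wt_SLxSLD _ _ (or_intror bB)) mulrACA.
- split=> [p h h'|h h1]; first by rewrite !formM Cinv Dinv.
  by rewrite formM mulf_neq0 ?C1 ?D1.
Qed.

Lemma branching_data0 : branching_data 0 0.
Proof.
exists unit, unit, (fun _ _ => 1), (fun _ _ => 1), (fun=> 1), (fun _ _ => 1).
have fE p h : branching_form (fun _ _ => 1 : F) (fun _ _ => 1) (fun (_ _ : unit) => 1) p h = 1.
  by rewrite /branching_form !big_const !card_unit /= rmorph1 !mulr1 !addr0.
split.
- by split=> t; exact: regular_const.
- by move=> p p'; rewrite big_const card_unit /= rmorph1 mulr1 addr0.
- by move=> h h'; rewrite expr0 big_const card_unit /= rmorph1 mulr1 addr0.
- split=> [u p _|b p _|]; rewrite ?oner_eq0 // /wt_SLxSL !wt_SL0 ?mulr1 //.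
- by split=> *; rewrite !fE // oner_eq0.
Qed.

Lemma branching_dataX lam k m : branching_data lam k -> branching_data (lam *+ m) (k * m).
Proof.
move=> dlam; elim: m => [|m IHm]; first by rewrite mulr0n muln0; exact: branching_data0.
by rewrite mulrS mulnS; exact: branching_dataM.
Qed.

Lemma branching_data_sum (I : Type) (r : seq I) (lam : I -> 'rV[int]_n * 'rV[int]_n)
    (k : I -> nat) :
  (forall i, branching_data (lam i) (k i)) ->
  branching_data (\sum_(i <- r) lam i) (\sum_(i <- r) k i).
Proof.
move=> dlam; elim: r => [|i r IHr]; first by rewrite !big_nil; exact: branching_data0.
by rewrite !big_cons; exact: branching_dataM.
Qed.

(** * Coefficients of $\Lambda^i\otimes(\Lambda^j)^\vee$ *)

Section MinorCoefficients.
Variables (i j : nat).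
Hypotheses (iN : (i <= N)%N) (jN : (j <= N)%N).
Local Notation T := ({ffun 'I_i -> 'I_N} * {ffun 'I_j -> 'I_N})%type.

(** The coordinates of the translate of the highest weight vector of
    $\Lambda^i\otimes(\Lambda^j)^\vee$: the minors of the first $i$ columns of $x$ and of the first
    $j$ rows of $y^{-1}$. *)
Definition minor_coef (t : T) p : F :=
  \det (colsel t.1 (SLval p.1)) * \det (rowsel t.2 (SLval p.2^-1%g)).

Definition minor_Phi p : F :=
  (i`!%:R * leading_minor i (SLval p.1)) *
  (j`!%:R * leading_minor j (SLval p.2^-1%g)).

Lemma minor_coef_regular t : regular_fun (@SLxSL_coord F N) (minor_coef t).
Proof.
apply: regularM.
  apply: (@regular_fst F n (fun x => \det (colsel t.1 (SLval x)))).
  by apply: regular_det => a b; exact: regular_entry.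
apply: (@regular_snd F n (fun x => \det (rowsel t.2 (SLval x^-1%g)))).
by apply: regular_det => a b; exact: regular_inv_entry.
Qed.

Lemma minor_coef_star t p : (minor_coef t (SLxSL_star p))^* =
  \det (rowsel t.1 (SLval p.1)) * \det (colsel t.2 (SLval p.2^-1%g)).
Proof.
rewrite /minor_coef rmorphM; congr (_ * _); first exact: conj_colsel.
have -> : SLval (SLxSL_star p).2^-1%g = adjmx (SLval p.2^-1%g) := SL_starV p.2.
exact: conj_rowsel.
Qed.

(** Cauchy-Binet in each factor. Inversion reverses products, so in the second factor the row minors
    come from [p'] and the column minors from [p]. *)
Lemma minor_PhiM p p' :
  minor_Phi (p * p')%g = \sum_t (minor_coef t (SLxSL_star p))^* * minor_coef t p'.
Proof.
transitivity ((\sum_(S : {ffun 'I_i -> 'I_N}) \det (rowsel S (SLval p.1)) * \det (colsel S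
  (SLval p'.1))) *
  (\sum_(S : {ffun 'I_j -> 'I_N}) \det (rowsel S (SLval p'.2^-1%g)) *
     \det (colsel S (SLval p.2^-1%g)))).
  by rewrite -!leading_minorM -!SL_mulE -invgM.
rewrite -sum_pairM; apply: eq_bigr => t _.
by rewrite minor_coef_star [X in _ * X]mulrC mulrACA.
Qed.

Lemma minor_Phi_neg u p : SLxSL_neg u ->
  minor_Phi (u * p)%g = wt_SLxSL (omega n i, - omega n j) u * minor_Phi p.
Proof.
case: u p => u u' [x y] [/= uL uU]; rewrite /minor_Phi /wt_SLxSL /=.
rewrite wt_SLN; last by right.
rewrite !wt_SL_omega //; [|by right; exact: SL_upper_inv|by left].
rewrite leading_minor_lowerM // -[invmx _]/(SLval (u' * y)^-1%g) invgM SL_mulE.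
by rewrite leading_minor_upperM //; [ring|exact: SL_upper_inv].
Qed.

Lemma minor_Phi_pos b p : SLxSL_pos b ->
  minor_Phi (p * b)%g = wt_SLxSL (omega n i, - omega n j) b * minor_Phi p.
Proof.
case: b p => b b' [x y] [/= bU bL]; rewrite /minor_Phi /wt_SLxSL /=.
rewrite wt_SLN; last by left.
rewrite !wt_SL_omega //; [|by left; exact: SL_lower_inv|by right].
rewrite leading_minor_upperM // -[invmx _]/(SLval (y * b')^-1%g) invgM SL_mulE.
by rewrite leading_minor_lowerM //; [ring|exact: SL_lower_inv].
Qed.

Lemma leading_minor1 l : (l <= N)%N -> leading_minor l (1%:M : 'M[F]_N) = 1.
Proof.
move=> lN; rewrite leading_minor_lower ?scalar_mx_is_trig // big1 // => k _.
by rewrite mxE eqxx.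
Qed.

Lemma minor_Phi1 : minor_Phi 1%g != 0.
Proof.
rewrite /minor_Phi -[(1%g : G).2]/(1%g : H) invg1.
rewrite (leading_minor1 iN) (leading_minor1 jN) !mulr1.
by rewrite mulf_neq0 // pnatr_eq0 -lt0n fact_gt0.
Qed.

End MinorCoefficients.

(** Taking [C] to be the identity matrix is the canonical invariant of
    $\Lambda^i\otimes(\Lambda^i)^\vee$. The form becomes $i!$ times the leading minor of $xy^{-1}$,
    visibly invariant under the diagonal on the right. *)
Lemma branching_data_spherical i : (i <= N)%N ->
  branching_data (omega n i, - omega n i) 0.
Proof.
move=> iN; pose T : finType := {ffun 'I_i -> 'I_N}.
exists (T * T)%type, unit, (@minor_coef i i), (fun _ _ => 1), (@minor_Phi i i).
exists (fun t _ => (t.1 == t.2)%:R).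
have fE p h : branching_form (@minor_coef i i) (fun _ _ => 1)
    (fun t (_ : unit) => (t.1 == t.2)%:R) p h =
    i`!%:R * leading_minor i (SLval (p.1 * p.2^-1)%g).
  rewrite SL_mulE leading_minorM /branching_form.
  transitivity (\sum_(t : T * T) (t.1 == t.2)%:R * (minor_coef t (SLxSL_star p))^*).
    by apply: eq_bigr => t _; rewrite big_const card_unit /= mulr1 addr0.
  rewrite -(pair_bigA _ (fun S S' => (S == S')%:R * (minor_coef (S, S') (SLxSL_star p))^*)) /=.
  apply: eq_bigr => S _; rewrite (bigD1 S) //= eqxx mul1r big1 ?addr0 => [|S' SS'].
    by rewrite minor_coef_star.
  by rewrite eq_sym (negPf SS') mul0r.
split.
- by split=> t; [exact: minor_coef_regular|exact: regular_const].
- exact: minor_PhiM.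
- by move=> h h'; rewrite expr0 big_const card_unit /= rmorph1 mulr1 addr0.
- split=> [u p|b p|]; [exact: minor_Phi_neg|exact: minor_Phi_pos|exact: minor_Phi1].
- split=> [[x y] h h'|h _]; rewrite !fE.
    congr (_ * leading_minor i (SLval _)); rewrite -[LHS]/(x * h' * (y * h')^-1)%g.
    by rewrite invgM mulgA mulgK.
  rewrite -[(1%g : G).2]/(1%g : H) invg1 mulg1.
  by rewrite leading_minor1 // mulr1 pnatr_eq0 -lt0n fact_gt0.
Qed.

Lemma sum_delta (I : finType) (i0 : I) (f : I -> F) : \sum_i (i == i0)%:R * f i = f i0.
Proof.
rewrite (bigD1 i0) //= eqxx mul1r big1 ?addr0 // => i /negPf ->.
by rewrite mul0r.
Qed.

(** Laplace expansion along the last column $he_1$ writes the minor as a combination of products of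
    the required coefficients. [C] collects its signs, and [Si S a] is [S] with its [a]-th value
    dropped. Equivariance holds because $x$, $y$ and $h$ enter only through a product in which $h'$
    can be moved from one factor to the other. *)
Lemma branching_data_fundamental i : (i < N)%N ->
  branching_data (omega n i.+1, - omega n i) 1.
Proof.
move=> iN; have iN' := ltnW iN.
pose Si (S : {ffun 'I_i.+1 -> 'I_N}) (a : 'I_i.+1) : {ffun 'I_i -> 'I_N} :=
    [ffun b : 'I_i => S (lift a b)].
pose C (t : {ffun 'I_i.+1 -> 'I_N} * {ffun 'I_i -> 'I_N}) (j : 'I_N) : F :=
  \sum_(a < i.+1) (-1) ^+ (a + i) * (t.2 == Si t.1 a)%:R * (j == t.1 a)%:R.
pose top (x : H) : 'M[F]_(i.+1, N) := \matrix_(a, j) SLval x (inord a) j.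
pose Z (y h : H) : 'M[F]_(N, i.+1) :=
  \matrix_(j, b) if (b < i)%N then SLval y^-1%g j (inord b) else SLval h j 0.
have fE p h : branching_form (@minor_coef i.+1 i) (fun j h => SLval h j 0) C p h =
    (i.+1)`!%:R * \det (top p.1 *m Z p.2 h).
  rewrite -Cauchy_Binet /branching_form.
  rewrite -(pair_bigA _ (fun S S' => \sum_j C (S, S') j *
    ((minor_coef (S, S') (SLxSL_star p))^* * SLval h j 0))) /=.
  apply: eq_bigr => S _.
  have -> : \det (\matrix_(a, b) top p.1 a (S b)) = \det (rowsel S (SLval p.1)).
    by congr determinant; apply/matrixP => a b; rewrite !mxE.
  rewrite [X in _ * X](expand_det_col _ ord_max) mulr_sumr.
  pose W (a : 'I_i.+1) (S' : {ffun 'I_i -> 'I_N}) := (-1) ^+ (a + i) * (\det (rowsel S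
    (SLval p.1)) *
    \det (colsel S' (SLval p.2^-1%g)) * SLval h (S a) 0).
  transitivity (\sum_(S' : {ffun 'I_i -> 'I_N}) \sum_a (S' == Si S a)%:R * W a S').
    apply: eq_bigr => S' _; rewrite minor_coef_star /C /=.
    under eq_bigr do rewrite big_distrl /=.
    rewrite exchange_big; apply: eq_bigr => a _ /=.
    rewrite -(sum_delta (S a) (fun j => (S' == Si S a)%:R * ((-1) ^+ (a + i) *
      (\det (rowsel S (SLval p.1)) * \det (colsel S' (SLval p.2^-1%g)) * SLval h j 0)))).
    by apply: eq_bigr => j _; ring.
  rewrite exchange_big; apply: eq_bigr => a _ /=.
  rewrite sum_delta /W !mxE ltnn /cofactor /=.
  have -> : row' a (col' ord_max (\matrix_(a, b) Z p.2 h (S a) b)) =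
      colsel (Si S a) (SLval p.2^-1%g).
    apply/matrixP => b c; rewrite !mxE ffunE lift_max ltn_ord.
    by congr (SLval _ _ (inord _)); exact: lift_max.
  ring.
exists ({ffun 'I_i.+1 -> 'I_N} * {ffun 'I_i -> 'I_N})%type, 'I_N, (@minor_coef i.+1 i).
exists (fun j h => SLval h j 0), (@minor_Phi i.+1 i), C.
split.
- by split=> t; [exact: minor_coef_regular|exact: regular_entry].
- exact: minor_PhiM.
- by move=> h h'; rewrite expr1 mxE; apply: eq_bigr => j _; rewrite /= !mxE; congr (_ * _);
  exact/esym/conjCK.
- split=> [u p|b p|]; [exact: minor_Phi_neg|exact: minor_Phi_pos|exact: minor_Phi1].
- split=> [[x y] h h'|h h1]; rewrite !fE.
    congr (_ * \det _).
    have -> : top ((x, y) * (h', h'))%g.1 = top x *m SLval h'.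
      by apply/matrixP => a b; rewrite !mxE; apply: eq_bigr => j _; rewrite mxE.
    have -> : Z (x, y).2 (h' * h)%g = SLval h' *m Z ((x, y) * (h', h'))%g.2 h.
      apply/matrixP => a b; rewrite !mxE.
      under [RHS]eq_bigr do rewrite mxE.
      case: ifP => bi; last by [].
      transitivity (SLval (h' * (y * h')^-1)%g a (inord b)).
        by rewrite invgM mulgA mulgV mul1g.
      by rewrite SL_mulE mxE.
    by rewrite mulmxA.
  (* At the identity, with a first column of ones in [h], the matrix is the identity with its last
     column replaced by ones: unipotent upper triangular. *)
  have -> : top (1%g : G).1 *m Z (1%g : G).2 h =
      \matrix_(a, b) if (b < i)%N then (a == b)%:R else 1.
    apply/matrixP => a b; rewrite mxE.
    transitivity (\sum_j (j == inord a)%:R * Z 1%g h j b).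
      by apply: eq_bigr => j _; rewrite [X in X * _]mxE mxE eq_sym.
    rewrite sum_delta !mxE h1 invg1 mxE; case: ifP => // bi.
    rewrite -val_eqE /= !inordK //; first exact: leq_trans bi iN'.
    exact: leq_trans (ltn_ord a) iN.
  rewrite mulf_neq0 ?pnatr_eq0 -?lt0n ?fact_gt0 // -det_tr det_trig.
    rewrite big1 ?oner_eq0 // => a _; rewrite !mxE eqxx; by case: ifP.
  apply/is_trig_mxP => a b ab; rewrite !mxE ifT; last exact: leq_trans ab (ltn_ord b).
  by rewrite -val_eqE /= gtn_eqF.
Qed.

End BranchingData.

(** * Torus weights of forms in the first column *)

Section PowerForms.
Variables (F : numClosedFieldType) (n : nat).
Local Notation N := n.+1.
Implicit Types (z w : 'cV[F]_N) (p : 'cV[F]_N -> F).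

(** Forms of degree $k$, given as combinations of $k$-th powers of linear forms because that is how
    functionals on $V_{k\omega_1}$ produce them. *)
Definition power_form k p := exists (L : nat) (r : 'I_L -> 'rV[F]_N) (c : 'I_L -> F),
  forall z, p z = \sum_l c l * (r l *m z) 0 0 ^+ k.

Definition scale_coord (j : 'I_N) (s : F) z : 'cV[F]_N :=
  \col_i (if i == j then s * z i 0 else z i 0).

Lemma power_formZ k p a z : power_form k p -> p (a *: z) = a ^+ k * p z.
Proof.
move=> [L [r [c pE]]]; rewrite !pE mulr_sumr; apply: eq_bigr => l _.
by rewrite -scalemxAr mxE exprMn mulrCA.
Qed.

Lemma power_form_line k p z w : power_form k p ->
  exists q : {poly F}, forall s, p (z + s *: w) = q.[s].
Proof.
move=> [L [r [c pE]]].
exists (\sum_l c l *: (((r l *m z) 0 0)%:P + (r l *m w) 0 0 *: 'X) ^+ k) => s.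
rewrite pE horner_sum; apply: eq_bigr => l _.
by rewrite mulmxDr -scalemxAr [X in X ^+ k]mxE [X in _ + X]mxE !hornerE (mulrC s).
Qed.

Lemma power_form_scale k p j z : power_form k p ->
  exists q : {poly F}, forall s, p (scale_coord j s z) = q.[s].
Proof.
move=> /(@power_form_line _ _ (scale_coord j 0 z) (z - scale_coord j 0 z))[q qE].
exists q => s; rewrite -qE; congr p; apply/matrixP => i a; rewrite !mxE ord1.
by case: eqP => _; rewrite ?mul0r ?subrr ?mulr0 ?addr0 ?add0r ?subr0.
Qed.

Lemma poly_eq_punctured (p q : {poly F}) : (forall s, s != 0 -> p.[s] = q.[s]) -> p = q.
Proof.
move=> pq; apply/eqP; rewrite -subr_eq0; apply/eqP/poly_eq0_punctured => s /pq E.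
by rewrite hornerD hornerN E subrr.
Qed.

(** A negative exponent would make a nonzero constant divisible by $X$; for a nonnegative one,
    $q(X^M)=cX^e$ contains only exponents divisible by $M$. *)
Lemma poly_character (q : {poly F}) (c : F) (e : int) (M : nat) : (0 < M)%N -> c != 0 ->
  (forall r, r != 0 -> q.[r ^+ M] = r ^ e * c) -> exists m : nat, e = (M * m)%:Z.
Proof.
move=> M0 c0 qE; case: e => e in qE *; last first.
  have : 'X^(e.+1) * (q \Po 'X^M) = c%:P.
    apply: poly_eq_punctured => r r0.
    rewrite hornerM hornerXn horner_comp hornerXn qE // hornerC mulrA.
    by rewrite -[r ^ Negz e]/((r ^+ e.+1)^-1) divff ?mul1r // expf_neq0.
  move/(congr1 (fun u : {poly F} => u.[0])); rewrite hornerM hornerXn hornerC expr0n /= mul0r.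
  by move/esym/eqP; rewrite (negPf c0).
have /(congr1 (fun u : {poly F} => u`_e)) : q \Po 'X^M = c *: 'X^e.
  apply: poly_eq_punctured => r r0.
  by rewrite horner_comp hornerXn qE // hornerZ hornerXn mulrC.
rewrite coef_comp_poly_Xn // coefZ coefXn eqxx mulr1.
case: ifP => [/dvdnP[m ->] _|_ /esym/eqP]; last by rewrite (negPf c0).
by exists m; rewrite mulnC.
Qed.

(** Clearing denominators gives $X^DP=X^bR$ with $R$ the reversal of $g$, of degree at most $D$;
    compare degrees. *)
Lemma poly_reverse_bound (P g : {poly F}) (b : nat) :
  (forall s, s != 0 -> P.[s] = s ^+ b * g.[s^-1]) -> (size P <= b.+1)%N.
Proof.
move=> PE; pose D := size g.
pose R := \poly_(i < D.+1) g`_(D - i).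
have RE s : s != 0 -> R.[s] = s ^+ D * g.[s^-1].
  move=> s0; rewrite horner_poly (horner_coef_wide _ (leqnSn D)) mulr_sumr.
  rewrite (reindex_inj rev_ord_inj) /=; apply: eq_bigr => i _.
  have iD : (i <= D)%N by rewrite -ltnS.
  rewrite subSS subKn // [RHS]mulrCA; congr (_ * _).
  by rewrite exprB ?unitfE // exprVn.
have E : 'X^D * P = 'X^b * R.
  apply: poly_eq_punctured => s s0.
  by rewrite !hornerM !hornerXn PE // RE // mulrCA.
have [->|P0] := eqVneq P 0; first by rewrite size_poly0.
have := congr1 (fun q : {poly F} => size q) E.
have R0 : R != 0.
  by apply: contraNneq P0 => R0; move/eqP: E; rewrite R0 mulr0 mulf_eq0 expf_eq0 polyX_eq0 andbF.
rewrite /= !(mulrC 'X^_) !size_mulXn //.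
have sR : (size R <= D.+1)%N := size_poly _ _.
by move=> sPR; rewrite -(leq_add2l D) sPR addnS -addSn addnC leq_add2r.
Qed.

(* The exponent of [r] by which [diag (1, .., r ^+ N, .., 1)] acts on a form of
   degree [k] and weight [theta]: [r^-1] times that matrix lies in SL. *)
Definition torus_exponent k (theta : 'rV[int]_n) (j : 'I_N) : int :=
  k%:Z + \sum_(i < n) theta 0 i * (N%:Z * (j <= i)%:R - i.+1%:Z).

Lemma exists_torus_elt (r : F) (j : 'I_N) : r != 0 ->
  exists2 t : SL F N, SLval t = diag_mx (\row_i (r^-1 * (if i == j then r ^+ N else 1)))
   & forall theta : 'rV[int]_n, wt_SL theta t =
       r ^ (\sum_(i < n) theta 0 i * (N%:Z * (j <= i)%:R - i.+1%:Z)).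
Proof.
move=> r0.
have dt : \det (diag_mx (\row_i (r^-1 * (if i == j then r ^+ N else 1)))) == 1.
  rewrite det_diag; under eq_bigr do rewrite mxE.
  rewrite big_split prodr_const card_ord /= -big_mkcond big_pred1_eq.
  by rewrite exprVn mulVf // expf_neq0.
exists (MkSL dt) => // theta; rewrite /wt_SL /wt_eval.
rewrite (big_morph (fun a : int => r ^ a) (id1 := 1) (op1 := *%R)) ?expr0z //; last first.
  by move=> a b; rewrite expfzDr.
apply: eq_bigr => i _; rewrite [theta 0 i * _]mulrC -exprz_exp; congr (_ ^ _).
under eq_bigr do rewrite !mxE eqxx mulr1n.
rewrite big_split /= expfzDr // mulrC; congr (_ * _).
  rewrite -big_mkcondr /=; case: leqP => ji.
    rewrite (big_pred1 j) ?mulr1 // => a; rewrite /=.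
    by case: eqP => [->|]; rewrite ?ji ?andbF.
  rewrite big_pred0 ?mulr0 ?expr0z // => a; apply/andP => -[ai /eqP aj].
  by rewrite aj leqNgt ji in ai.
rewrite -[LHS](big_ord_widen N (fun=> r^-1) (leqW (ltn_ord i))).
by rewrite prodr_const card_ord exprVn.
Qed.

(** Once the exponents are known to be $Nm_j$, this says $\theta_j=m_j-m_{j+1}$, that is
    $\theta=\sum_j m_j\epsilon_j$. *)
Lemma torus_exponent_diff k (theta : 'rV[int]_n) (j : 'I_n) :
  torus_exponent k theta (widen_ord (leqnSn n) j) - torus_exponent k theta (lift ord0 j)
  = N%:Z * theta 0 j.
Proof.
rewrite /torus_exponent opprD addrACA subrr add0r -sumrB.
rewrite (bigD1 j) //= big1 => [|i ij].
  by rewrite /bump leq0n add1n ltnn leqnn /= mulr1 mulr0; ring.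
rewrite /bump /= add1n [(j <= i)%N]leq_eqVlt.
have /negPf -> : (j : nat) != i by rewrite eq_sym.
by rewrite /= subrr.
Qed.

(** The product over $j$ of the torus elements $r^{-1}\mathrm{diag}(1,\dots,r^N,\dots,1)$ is 1, so
    [theta] drops out. For exponents $Nm_j$ the result reads $\sum_j m_j=k$. *)
Lemma sum_torus_exponent k (theta : 'rV[int]_n) :
  \sum_j torus_exponent k theta j = N%:Z * k%:Z.
Proof.
rewrite /torus_exponent big_split /= sumr_const card_ord exchange_big /= big1 => [|i _].
  by rewrite addr0 -mulr_natl natz.
rewrite -mulr_sumr sumrB -mulr_sumr sumr_const card_ord.
have -> : \sum_(j < N) ((j <= i)%N : nat)%:R = i.+1%:Z.
  rewrite -natr_sum -big_mkcond /= -[X in (X)%:R](big_ord_widen N (fun=> 1%N) (leqW (ltn_ord i))).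
  by rewrite sum1_card card_ord natz.
by rewrite -mulr_natl natz subrr mulr0.
Qed.

(** The matrix is lower triangular; the second diagonal entry, available since [0 < n], is the
    inverse of the first and restores determinant 1. *)
Lemma exists_SL_col z : (0 < n)%N -> z 0 0 != 0 -> exists h : SL F N, col 0 (SLval h) = z.
Proof.
move=> n0 z0; pose i1 : 'I_N := inord 1.
have i10 : (i1 == 0) = false by rewrite -val_eqE /= inordK.
pose A : 'M[F]_N := \matrix_(i, j) if j == 0 then z i 0 else
  if i == j then (if j == i1 then (z 0 0)^-1 else 1) else 0.
have dA : \det A == 1.
  rewrite det_trig.
    rewrite (bigD1 0) //= (bigD1 i1) ?i10 //=.
    rewrite !mxE !eqxx i10 big1 => [|i /andP[i0 ii]].
      by rewrite mulr1 divff.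
    by rewrite mxE (negPf i0) eqxx (negPf ii).
  apply/is_trig_mxP => i j ij; rewrite mxE.
  have [j0|_] := eqVneq j 0; first by rewrite j0 in ij.
  by rewrite -val_eqE ltn_eqF.
by exists (MkSL dA); apply/matrixP => i j; rewrite !mxE ord1.
Qed.

Section TorusWeight.
Variables (k : nat) (p : 'cV[F]_N -> F) (theta : 'rV[int]_n).
Hypotheses (n_gt0 : (0 < n)%N) (p_form : power_form k p).
Hypothesis p_weight : forall t h : SL F N, is_diag_mx (SLval t) ->
  p (SLval t *m col 0 (SLval h)) = wt_SL theta t * p (col 0 (SLval h)).

(** The hypothesis concerns first columns of group elements. On the line through [z] in the
    direction of the first basis vector all points but one are such columns, and both sides are
    polynomial along it. *)
Lemma power_form_weight (t : SL F N) z : is_diag_mx (SLval t) ->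
  p (SLval t *m z) = wt_SL theta t * p z.
Proof.
move=> tD; pose z' := scale_coord 0 0 z; pose e : 'cV[F]_N := delta_mx 0 0.
have [q qE] := power_form_line z' e p_form.
have [q' qE'] := power_form_line (SLval t *m z') (SLval t *m e) p_form.
have zE : z = z' + z 0 0 *: e.
  apply/matrixP => i j; rewrite !mxE ord1 eqxx andbT.
  by case: eqP => [->|_]; rewrite ?mul0r ?mulr1 ?add0r ?mulr0 ?addr0.
suff qq : q' = wt_SL theta t *: q.
  by rewrite {1}zE mulmxDr -scalemxAr qE' qq hornerZ -qE -zE.
apply: poly_eq_punctured => s s0.
rewrite hornerZ -qE -qE' scalemxAr -mulmxDr.
have [|h <-] := @exists_SL_col (z' + s *: e) n_gt0; last exact: p_weight.
by rewrite !mxE eqxx mul0r add0r mulr1.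
Qed.

Lemma power_form_scale_root r j z : r != 0 ->
  p (scale_coord j (r ^+ N) z) = r ^ torus_exponent k theta j * p z.
Proof.
move=> r0; have [t tE wtE] := exists_torus_elt j r0.
have -> : scale_coord j (r ^+ N) z = r *: (SLval t *m z).
  rewrite tE mul_diag_mx; apply/matrixP => i a; rewrite !mxE ord1 !mulrA divff // mul1r.
  by case: eqP => _; rewrite ?mul1r.
rewrite (power_formZ _ _ p_form) power_form_weight; last by rewrite tE diag_mx_is_diag.
by rewrite wtE mulrA /torus_exponent expfzDr.
Qed.

Lemma power_form_exponents z : p z != 0 ->
  exists m : 'I_N -> nat, forall j, torus_exponent k theta j = (N * m j)%:Z.
Proof.
move=> pz0; suff /choice[m mE] j : exists m : nat, torus_exponent k theta j = (N * m)%:Z.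
  by exists m.
have [q qE] := power_form_scale j z p_form.
apply: (@poly_character q (p z)) => // r r0.
by rewrite -qE power_form_scale_root.
Qed.

(** The vector of ones is turned into [z] one coordinate at a time, each change contributing its own
    power. Polynomiality in the scaling factor covers the zero coordinates. *)
Lemma power_form_monomial (m : 'I_N -> nat) z :
  (forall j, torus_exponent k theta j = (N * m j)%:Z) ->
  p z = (\prod_j z j 0 ^+ m j) * p (const_mx 1).
Proof.
move=> mE.
have scaleE j s w : p (scale_coord j s w) = s ^+ m j * p w.
  have [q qE] := power_form_scale j w p_form; rewrite qE.
  have -> : q = p w *: 'X^(m j); last by rewrite hornerZ hornerXn mulrC.
  apply: poly_eq_punctured => x x0; rewrite -qE hornerZ hornerXn mulrC.
  have r0 : N.-root x != 0 by rewrite rootC_eq0.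
  by rewrite -{1}(rootCK (ltn0Sn n) x) power_form_scale_root // mE -exprnP exprM rootCK.
pose zs (s : seq 'I_N) : 'cV[F]_N := \col_i if i \in s then z i 0 else 1.
have zsE s : uniq s -> p (zs s) = (\prod_(j <- s) z j 0 ^+ m j) * p (const_mx 1).
  elim: s => [_|j s IHs /= /andP[js us]].
    by rewrite big_nil mul1r; congr p; apply/matrixP => i a; rewrite !mxE.
  rewrite big_cons -mulrA -IHs // -scaleE; congr p; apply/matrixP => i a.
  by rewrite !mxE in_cons; have [->|ij] := eqVneq i j; rewrite ?(negPf js) ?mulr1.
have -> : z = zs (index_enum 'I_N).
  by apply/matrixP => i a; rewrite mxE ord1 mem_index_enum.
by rewrite zsE ?index_enum_uniq //; congr (_ * _); apply: eq_bigr => j _;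
  rewrite mxE mem_index_enum.
Qed.

End TorusWeight.
End PowerForms.

(** * Intertwiners *)

Section RankTwo.
Variables (F : numClosedFieldType) (n : nat) (j : 'I_n).
Local Notation N := n.+1.
Let j0 : 'I_N := widen_ord (leqnSn n) j.
Let j1 : 'I_N := lift ord0 j.
Let j0E : j0 = j :> nat. Proof. by []. Qed.
Let j1E : j1 = j.+1 :> nat. Proof. by rewrite /j1 /= /bump. Qed.

Definition block2 (a b c d : F) : 'M[F]_N := \matrix_(x, y)
  if x == j0 then a *+ (y == j0) + b *+ (y == j1)
  else if x == j1 then c *+ (y == j0) + d *+ (y == j1) else (x == y)%:R.

Lemma block2_neq : (j1 == j0) = false.
Proof. by apply/eqP => /(congr1 (@nat_of_ord N)); rewrite j1E j0E => /eqP; rewrite gtn_eqF. Qed.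

Lemma block2_mulE a b c d q (A : 'M[F]_(N, q)) x y :
  (block2 a b c d *m A) x y = if x == j0 then a * A j0 y + b * A j1 y
    else if x == j1 then c * A j0 y + d * A j1 y else A x y.
Proof.
have two (e f : F) : \sum_k (e *+ (k == j0) + f *+ (k == j1)) * A k y =
    e * A j0 y + f * A j1 y.
  rewrite (bigD1 j0) //= (bigD1 j1) ?block2_neq //= !eqxx.
  rewrite (eq_sym j0) block2_neq big1 => [|k /andP[k0 k1]].
    by rewrite !mulr1n !mulr0n !addr0 add0r.
  by rewrite (negPf k0) (negPf k1) !mulr0n addr0 mul0r.
rewrite mxE; under eq_bigr do rewrite mxE.
case: eqP => _; first exact: two.
case: eqP => _; first exact: two.
rewrite (bigD1 x) //= eqxx mul1r big1 ?addr0 // => k kx.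
by rewrite eq_sym (negPf kx) mul0r.
Qed.

Lemma block2_diag a b c d : \prod_x block2 a b c d x x = a * d.
Proof.
rewrite (bigD1 j0) //= (bigD1 j1) ?block2_neq //= big1 => [|x /andP[x0 x1]].
  by rewrite !mxE !eqxx block2_neq (eq_sym j0) block2_neq mulr1 addr0 add0r.
by rewrite mxE (negPf x0) (negPf x1) eqxx.
Qed.

Lemma block2_lower a c d : is_trig_mx (block2 a 0 c d).
Proof.
apply/is_trig_mxP => x y xy; rewrite mxE mul0rn addr0.
have [xj|_] := eqVneq x j0.
  have /negPf -> : y != j0 by apply: contraTneq xy => ->; rewrite xj ltnn.
  by [].
have [xj|_] := eqVneq x j1.
  have /negPf -> : y != j1 by apply: contraTneq xy => ->; rewrite xj ltnn.
  have /negPf -> : y != j0.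
    by apply: contraTneq xy => ->; rewrite xj j0E j1E -leqNgt leqnSn.
  by rewrite addr0.
by rewrite -val_eqE ltn_eqF.
Qed.

Lemma block2_upper a b d : upper_triangular (block2 a b 0 d).
Proof.
apply/upper_triangularP => x y yx; rewrite mxE mul0rn add0r.
have [xj|_] := eqVneq x j0.
  have /negPf -> : y != j1.
    by apply: contraTneq yx => ->; rewrite xj j0E j1E -leqNgt leqnSn.
  have /negPf -> : y != j0 by apply: contraTneq yx => ->; rewrite xj ltnn.
  by rewrite addr0.
have [xj|_] := eqVneq x j1.
  by have /negPf -> : y != j1 by apply: contraTneq yx => ->; rewrite xj ltnn.
by rewrite -val_eqE gtn_eqF.
Qed.

(** All partial products of the diagonal are 1 except the one ending at the [j]-th entry, which is
    $s^{-1}$. *)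
Lemma wt_block2 (theta : 'rV[int]_n) (u : SL F N) b c (s : F) : s != 0 ->
  SLval u = block2 s^-1 b c s -> wt_SL theta u = s ^ (- theta 0 j).
Proof.
move=> s0 uE; rewrite /wt_SL /wt_eval uE.
have pE (i : 'I_n) : \prod_(x < N | (x <= i)%N) block2 s^-1 b c s x x =
    if i == j then s^-1 else 1.
  rewrite big_mkcond (bigD1 j0) // (bigD1 j1) ?block2_neq //=.
  rewrite [X in _ * (_ * X)]big1 => [|x /andP[x0 x1]]; last first.
    by rewrite mxE (negPf x0) (negPf x1) eqxx if_same.
  rewrite !mxE !eqxx block2_neq (eq_sym j0) block2_neq addr0 add0r mulr1 ?j0E ?j1E /bump /= ?add1n.
  have [->|ij] := eqVneq i j; first by rewrite leqnn ltnn mulr1.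
  rewrite [(j <= i)%N]leq_eqVlt.
  have /negPf -> : (j : nat) != i by rewrite eq_sym.
  by case: ltnP; rewrite ?mulr1 // mulVf.
rewrite (bigD1 j) //= pE eqxx big1 ?mulr1 => [|i ij].
  by rewrite -exprz_inv.
by rewrite pE (negPf ij) exp1rz.
Qed.

Lemma wt_unipotent (theta : 'rV[int]_n) (u : SL F N) :
  (forall i, SLval u i i = 1) -> wt_SL theta u = 1.
Proof.
move=> u1; rewrite -[RHS](@wt_eval1 F n theta); apply: wt_eval_diag => i.
by rewrite u1 mxE eqxx.
Qed.

(* The 2 x 2 blocks of the lower elementary matrix, of an upper triangular
   matrix and of their quotient, in [1 0; s 1] = [1/s 1; 0 s] [0 -1; 1 1/s]. *)
Lemma exists_rank_two_factorization :
  exists (e bu mm : F -> SL F N),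
  [/\ forall s, SLval (e s) = block2 1 0 s 1,
    forall s, s != 0 -> SLval (bu s) = block2 s^-1 1 0 s,
    forall r, r != 0 -> SLval (mm r) = block2 0 (-1) 1 r &
    forall s, s != 0 -> e s = (bu s * mm (s^-1)%R)%g].
Proof.
have de s : \det (block2 1 0 s 1) == 1.
  by rewrite (det_trig (block2_lower _ _ _)) block2_diag mulr1.
have db s : s != 0 -> \det (block2 s^-1 1 0 s) == 1.
  move=> s0; rewrite -det_tr (det_trig (block2_upper _ _ _)).
  by under eq_bigr do rewrite mxE; rewrite block2_diag mulVf.
have bm s : s != 0 -> block2 s^-1 1 0 s *m block2 0 (-1) 1 s^-1 = block2 1 0 s 1.
  move=> s0; apply/matrixP => x y; rewrite block2_mulE !mxE.
  rewrite !eqxx block2_neq; case: eqP => [_|x0].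
    by case: (y == j0); case: (y == j1); rewrite ?mulr1n ?mulr0n; ring.
  case: eqP => [_|//].
  by rewrite mul0r add0r mulrDr !mulrnAr mulr1 divff.
have dm r : r != 0 -> \det (block2 0 (-1) 1 r) == 1.
  move=> r0; have r0' : r^-1 != 0 by rewrite invr_eq0.
  have := congr1 determinant (bm _ r0'); rewrite det_mulmx (eqP (db _ r0')) (eqP (de _)).
  by rewrite mul1r invrK => ->.
exists (fun s => MkSL (de s)), (fun s => insubd (SLone F N) (block2 s^-1 1 0 s)),
  (fun r => insubd (SLone F N) (block2 0 (-1) 1 r)).
have valE (A : 'M_N) : \det A == 1 -> SLval (insubd (SLone F N) A) = A.
  by move=> dA; rewrite -[LHS]/(\val (insubd _ A)) insubdK.
split=> // [s s0|r r0|s s0]; rewrite ?valE ?db ?dm //.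
by apply: SLval_inj; rewrite SL_mulE !valE ?db ?dm ?invr_eq0 //= bm.
Qed.

End RankTwo.

(** * Equivariant maps from $V_{k\omega_1}$ to the restriction *)

Section Branching.
Variables (F : numClosedFieldType) (n k : nat) (lam : 'rV[int]_n * 'rV[int]_n).
Hypothesis n_gt0 : (0 < n)%N.
Local Notation N := n.+1.
Local Notation H := (SL F N).
Local Notation G := (SL F N * SL F N)%type.

Lemma wt_SL_komega1 (u : H) : lower_SL u \/ upper_SL u ->
  wt_SL (omega n 1 *+ k) u = SLval u 0 0 ^+ k.
Proof.
move=> ut; elim: k => [|j IHj]; first by rewrite mulr0n expr0 wt_SL0.
rewrite mulrS exprS (wt_SLD _ _ ut) IHj (wt_SL_omega _ ut) //; congr (_ * _).
by rewrite /leading_minor det_mx11 mxE; congr (SLval u _ _); apply/val_inj; rewrite /= inordK.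
Qed.

Variables (dV dW : nat) (rho : G -> 'M[F]_dV) (sigma : H -> 'M[F]_dW).
Variables (xi : 'rV[F]_dV) (zeta : 'rV[F]_dW) (w : 'cV[F]_dW).
Hypotheses (rho_rat : rational_rep (@SLxSL_coord F N) rho)
  (sigma_rat : rational_rep (@SL_coord F N) sigma).
Hypotheses (xi_eigen : eigenrow rho (@SLxSL_neg F n) (wt_SLxSL lam) xi)
  (xi_cyclic : cyclic_row rho xi).
Hypotheses (w_cyclic : cyclic_col sigma w) (zeta_cyclic : cyclic_row sigma zeta).
Hypothesis sigma_coef : forall h, zeta *m (sigma h *m w) = (SLval h 0 0 ^+ k)%:M.

Definition intertwiner (A : 'M[F]_(dV, dW)) := forall h, rho (h, h) *m A = A *m sigma h.

(** The hypothesis gives [xi *m A = 0]. On the dense set $(B^-\times B)\cdot H$ the functional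
    [xi *m rho g *m A] is a scalar multiple of a translate of [xi *m A], so it vanishes for every
    [g]. *)
Lemma intertwiner_eq0 A : intertwiner A ->
  (forall h, xi *m (A *m (sigma h *m w)) = 0) -> A = 0.
Proof.
move=> Aint A0; have [_ rhoM _] := rho_rat.
have xiA : xi *m A = 0 by apply: w_cyclic => h; rewrite -mulmxA A0.
suff colA (x : 'cV_dW) : A *m x = 0.
  apply/matrixP => i j; have /matrixP/(_ i 0) := colA (delta_mx j 0).
  by rewrite -colE !mxE.
apply: xi_cyclic => g; apply: mx_scalar0.
have fr := regular_mxcoef xi (A *m x) rho_rat.
apply: (SLxSL_diagonal_dense fr) => u b h uL bU.
rewrite -[((u * h)%g, (b * h)%g)]/((u, b) * (h, h))%g rhoM -mulmxA (mulmxA xi).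
rewrite xi_eigen; last by split.
by rewrite (mulmxA (rho _) A) Aint -scalemxAl !mulmxA xiA !mul0mx scaler0 mxE.
Qed.

Lemma intertwiner_neq0 A (p : 'cV_N -> F) : intertwiner A ->
  (forall h, xi *m A *m (sigma h *m w) = (p (col 0 (SLval h)))%:M) -> A != 0 ->
  exists z, p z != 0.
Proof.
move=> Aint pE A0; apply: contrapT => p0; case/eqP: A0; apply: intertwiner_eq0 => // h.
rewrite mulmxA pE; have -> : p (col 0 (SLval h)) = 0.
  by apply/eqP; apply: contrapT => /negP ph; apply: p0; exists (col 0 (SLval h)).
by rewrite raddf0.
Qed.

(** Translates of [zeta] span the dual space, and [zeta *m sigma (hs l)] pairs with [sigma h *m w]
    to the $k$-th power of the first row of [hs l] applied to the first column of [h]. *)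
Lemma functional_power_form (f : 'rV[F]_dW) : exists2 p, @power_form F n k p &
  forall h, f *m (sigma h *m w) = (p (col 0 (SLval h)))%:M.
Proof.
have [_ sigmaM _] := sigma_rat.
have [|hs hsu] := @extract_row_basis F H dW (fun h => zeta *m sigma h).
  by move=> v v0; apply: zeta_cyclic => g; rewrite mulmxA v0.
pose c := f *m invmx (\matrix_l (zeta *m sigma (hs l))).
have fE : f = \sum_l c 0 l *: (zeta *m sigma (hs l)).
  rewrite -[LHS](mulmxKV hsu) -/c mulmx_sum_row; apply: eq_bigr => l _.
  by rewrite rowK.
exists (fun z => \sum_l c 0 l * (row 0 (SLval (hs l)) *m z) 0 0 ^+ k).
  by exists dW, (fun l => row 0 (SLval (hs l))), (fun l => c 0 l).
move=> h; rewrite {1}fE mulmx_suml raddf_sum /=; apply: eq_bigr => l _.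
rewrite -scalemxAl -mulmxA (mulmxA (sigma _)) -sigmaM sigma_coef scale_scalar_mx.
congr (_ * _ ^+ _)%:M; rewrite SL_mulE !mxE; apply: eq_bigr => i _.
by rewrite !mxE.
Qed.

Lemma intertwiner_weight A p : intertwiner A ->
  (forall h, xi *m A *m (sigma h *m w) = (p (col 0 (SLval h)))%:M) ->
  forall t h : H, is_diag_mx (SLval t) ->
  p (SLval t *m col 0 (SLval h)) = wt_SL (lam.1 + lam.2) t * p (col 0 (SLval h)).
Proof.
move=> Aint pE t h tD; have [_ rhoM _] := rho_rat; have [_ sigmaM _] := sigma_rat.
have tU : upper_SL t by exact: diag_upper.
have tL : lower_SL t by exact: is_diag_mx_is_trig.
have : xi *m A *m (sigma (t * h)%g *m w) =
    wt_SLxSL lam (t, t) *: (xi *m A *m (sigma h *m w)).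
  rewrite sigmaM -!mulmxA (mulmxA A) -Aint -mulmxA (mulmxA xi) xi_eigen -?scalemxAl //.
rewrite !pE scale_scalar_mx => /matrixP/(_ 0 0); rewrite !mxE eqxx !mulr1n.
rewrite (wt_SLD _ _ (or_introl tL)) -[wt_SLxSL lam (t, t)]/(wt_SL lam.1 t * wt_SL lam.2 t).
move=> <-; congr p.
by rewrite SL_mulE !colE mulmxA.
Qed.

(** The exponents of the monomial depend only on [lam] and [k], so the two forms are proportional,
    and a form determines its intertwiner. *)
Lemma intertwiner_line A B : intertwiner A -> intertwiner B -> A != 0 ->
  exists c, B = c *: A.
Proof.
move=> Aint Bint A0.
have [p pf pE] := functional_power_form (xi *m A).
have [q qf qE] := functional_power_form (xi *m B).
have pw := intertwiner_weight Aint pE; have qw := intertwiner_weight Bint qE.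
have [z pz] := intertwiner_neq0 Aint pE A0.
have [m mE] := power_form_exponents n_gt0 pf pw pz.
have pM := power_form_monomial n_gt0 pf pw _ mE.
have qM := power_form_monomial n_gt0 qf qw _ mE.
have p1 : p (const_mx 1) != 0.
  by apply: contraNneq pz => p1; rewrite pM p1 mulr0.
exists (q (const_mx 1) / p (const_mx 1)); apply/eqP; rewrite -subr_eq0; apply/eqP.
apply: intertwiner_eq0 => h.
  by rewrite mulmxBr mulmxBl Bint -scalemxAr Aint scalemxAl.
rewrite mulmxA mulmxBr -scalemxAr mulmxBl qE -scalemxAl pE.
rewrite (pM (col 0 _)) (qM (col 0 _)) scale_scalar_mx mulrCA divfK //.
by rewrite subrr.
Qed.

(** Evaluate the monomial at [e s] applied to the vector of ones: the value is a nonzero constant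
    times $(s+1)^{m_{j+1}}$. By equivariance it is also a coefficient at [(1, e s)], since the
    unipotent [e s] acts trivially on [xi] through the first factor. Factoring [e s], the upper
    triangular part contributes $s^b$ and the rest is polynomial in $s^{-1}$, so the degree is at
    most $b$. *)
Lemma intertwiner_exponents A : intertwiner A -> A != 0 ->
  exists m : 'I_N -> nat,
    (forall j, torus_exponent k (lam.1 + lam.2) j = (N * m j)%:Z) /\
    forall (j : 'I_n) (b : nat), lam.2 0 j = - b%:Z -> (m (lift ord0 j) <= b)%N.
Proof.
move=> Aint A0.
have [p pf pE] := functional_power_form (xi *m A).
have pw := intertwiner_weight Aint pE.
have [z pz] := intertwiner_neq0 Aint pE A0.
have [m mE] := power_form_exponents n_gt0 pf pw pz.
have pM := power_form_monomial n_gt0 pf pw _ mE.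
have p1 : p (const_mx 1) != 0.
  by apply: contraNneq pz => p1; rewrite pM p1 mulr0.
exists m; split=> // j b lamj; have [_ rhoM _] := rho_rat; have [_ sigmaM _] := sigma_rat.
have [e [bu [mm [eE buE mmE fac]]]] := exists_rank_two_factorization F j.
have [|h hE] := @exists_SL_col F n (const_mx 1) n_gt0; first by rewrite mxE oner_eq0.
pose x := A *m (sigma h *m w).
have eL s : lower_SL (e s) by rewrite /lower_SL eE; exact: block2_lower.
have buU s : s != 0 -> upper_SL (bu s) by move=> /buE buE'; rewrite /upper_SL buE';
  exact: block2_upper.
have psiE s : p (SLval (e s) *m const_mx 1) = (xi *m (rho (1%g, e s) *m x)) 0 0.
  have := pE (e s * h)%g; have -> : col 0 (SLval (e s * h)%g) = SLval (e s) *m const_mx 1.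
    by rewrite -hE SL_mulE !colE mulmxA.
  rewrite sigmaM -!mulmxA (mulmxA A) -Aint -mulmxA -/x.
  have -> : (e s, e s) = ((e s, 1) * (1, e s))%g.
    by rewrite -[RHS]/((e s * 1)%g, (1 * e s)%g) mulg1 mul1g.
  rewrite rhoM -mulmxA (mulmxA xi) xi_eigen; last by split; [exact: eL|exact: upper_SL1].
  have -> : wt_SLxSL lam (e s, 1%g) = 1.
    rewrite -[LHS]/(wt_SL lam.1 (e s) * wt_SL lam.2 1%g) wt_SL1 mulr1.
    apply: wt_unipotent => i; rewrite eE mxE; case: eqP => _; first by rewrite mul0rn addr0.
    by case: eqP => _; rewrite ?mulr0n ?add0r ?eqxx.
  by rewrite scale1r => ->; rewrite mxE eqxx mulr1n.
pose P (phi : F -> F) := exists q : {poly F}, forall r, r != 0 -> phi r = q.[r].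
have [g gE] : P (fun r => (xi *m (rho (1%g, mm r) *m x)) 0 0).
  apply: (@regular_ind_SLxSL F n F P (fun r => (1%g, mm r)) _ _ _ _ _ _ _
    (regular_mxcoef xi x rho_rat)).
  - by move=> u u' uu [q qE]; exists q => r r0; rewrite -uu qE.
  - by move=> a; exists a%:P => r _; rewrite hornerC.
  - by move=> u u' [q qE] [q' qE']; exists (q + q') => r r0; rewrite hornerD qE // qE'.
  - by move=> u u' [q qE] [q' qE']; exists (q * q') => r r0; rewrite hornerM qE // qE'.
  - by move=> a c; exists ((SLval (1%g : H) a c)%:P) => r _; rewrite hornerC.
  - move=> a c; exists (if a == widen_ord (leqnSn n) j then (- 1) *+ (c == lift ord0 j)
      else if a == lift ord0 j then 1 *+ (c == widen_ord (leqnSn n) j) + 'X *+ (c == lift ord0 j)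
      else (a == c)%:R) => r r0; rewrite /= mmE // mxE.
    case: eqP => _; first by rewrite mul0rn add0r hornerMn hornerN hornerC.
    case: eqP => _; first by rewrite hornerD !hornerMn hornerC hornerX.
    by rewrite -[RHS]horner_evalE rmorph_nat.
have psiM s : p (SLval (e s) *m const_mx 1) = (s + 1) ^+ m (lift ord0 j) * p (const_mx 1).
  rewrite pM eE; congr (_ * _); rewrite (bigD1 (lift ord0 j)) //= big1 ?mulr1 => [|i ij].
    by rewrite block2_mulE block2_neq eqxx !mxE !mulr1.
  rewrite block2_mulE (negPf ij) !mxE; case: eqP => _; rewrite ?expr1n //.
  by rewrite mul0r addr0 mulr1 expr1n.
pose Q := p (const_mx 1) *: ('X - (-1)%:P) ^+ m (lift ord0 j).
rewrite -ltnS; have <- : size Q = (m (lift ord0 j)).+1 by rewrite /Q size_scale // size_exp_XsubC.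
apply: (@poly_reverse_bound F Q g b) => s s0.
rewrite /Q hornerZ horner_exp hornerXsubC opprK mulrC -psiM psiE fac //.
have -> : (1, bu s * mm (s^-1)%R)%g = ((1, bu s) * (1, mm (s^-1)%R))%g :> G.
  by rewrite -[RHS]/((1 * 1)%g, (bu s * mm (s^-1)%R)%g) mulg1.
rewrite rhoM -mulmxA (mulmxA xi) xi_eigen; last first.
  by split; [exact: lower_SL1|exact: buU].
rewrite -[wt_SLxSL _ _]/(wt_SL lam.1 1%g * wt_SL lam.2 (bu s)) wt_SL1 mul1r.
rewrite (wt_block2 _ s0 (buE s s0)) lamj opprK -scalemxAl mxE gE ?invr_eq0 //.
Qed.

End Branching.

(** * Multiplicities *)

(** Eigenproperties of the function [Phi] pass to [v] and [xi] because vectors and functionals are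
    separated by their matrix coefficients. *)
Lemma realization_irreducible (F : numFieldType) (gT : groupType) m
    (coord : gT -> 'I_m -> F) (Bp Bm : gT -> Prop) (chi : gT -> F) d
    (rho : gT -> 'M[F]_d) (xi : 'rV_d) (v : 'cV_d) (Phi : gT -> F) :
  big_cell coord Bp Bm chi -> rational_rep coord rho ->
  cyclic_col rho v -> cyclic_row rho xi ->
  (forall g, xi *m (rho g *m v) = (Phi g)%:M) ->
  (forall u g, Bm u -> Phi (u * g)%g = chi u * Phi g) ->
  (forall b g, Bp b -> Phi (g * b)%g = chi b * Phi g) -> Phi 1%g != 0 ->
  [/\ irreducible_rep rho, eigencol rho Bp chi v, eigenrow rho Bm chi xi & v != 0].
Proof.
move=> cell rat vcyc xcyc PhiE Phiu Phib Phi1; have [rho1 rhoM _] := rat.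
have xiv : xi *m v = (Phi 1%g)%:M by rewrite -PhiE rho1 mul1mx.
have vB : eigencol rho Bp chi v.
  move=> b bB; apply/eqP; rewrite -subr_eq0; apply/eqP/xcyc => g.
  rewrite mulmxBr mulmxBr (mulmxA (rho g)) -rhoM PhiE Phib // -!scalemxAr PhiE.
  by rewrite scale_scalar_mx subrr.
have xB : eigenrow rho Bm chi xi.
  move=> u uB; apply/eqP; rewrite -subr_eq0; apply/eqP/vcyc => g.
  rewrite mulmxBl -mulmxA (mulmxA (rho u)) -rhoM PhiE Phiu // -scalemxAl PhiE.
  by rewrite scale_scalar_mx subrr.
have xiv0 : xi *m v != 0.
  by apply: contraNneq Phi1; rewrite xiv => /matrixP/(_ 0 0); rewrite !mxE mulr1n => ->.
split=> //; first exact: (irreducible_of_cyclic cell rat vB vcyc xB xcyc).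
by apply: contraNneq xiv0 => ->; rewrite mulmx0.
Qed.

Lemma irreducible_cyclic_col (F : fieldType) (gT : groupType) m
    (coord : gT -> 'I_m -> F) d (rho : gT -> 'M[F]_d) (v : 'cV_d) :
  rational_rep coord rho -> irreducible_rep rho -> v != 0 -> cyclic_col rho v.
Proof.
move=> [rho1 rhoM _] rirr v0 eta eta0.
apply: (@irreducible_stable_set _ _ _ rho (fun x => exists g, x = rho g *m v)) v0 _ _ => //.
- by move=> h x [g ->]; exists (h * g)%g; rewrite mulmxA rhoM.
- by exists 1%g; rewrite rho1 mul1mx.
- by move=> x [g ->].
Qed.

Lemma irreducible_cyclic_row (F : fieldType) (gT : groupType) m
    (coord : gT -> 'I_m -> F) d (rho : gT -> 'M[F]_d) (xi : 'rV_d) :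
  rational_rep coord rho -> irreducible_rep rho -> xi != 0 -> cyclic_row rho xi.
Proof.
move=> [rho1 rhoM _] rirr xi0 x x0; apply/eqP; apply: contraNT xi0 => xn0; apply/eqP.
apply: (@irreducible_stable_set _ _ _ rho
  (fun x => forall g, xi *m (rho g *m x) = 0)) x0 xn0 _ _ => //.
- by move=> h y y0 g; rewrite (mulmxA (rho g)) -rhoM.
- by move=> y /(_ 1%g); rewrite rho1 mul1mx.
Qed.

Section Multiplicity.
Variables (F : numClosedFieldType) (n : nat) (lam : 'rV[int]_n * 'rV[int]_n) (k : nat).
Hypothesis n_gt0 : (0 < n)%N.
Local Notation N := n.+1.
Local Notation H := (SL F N).
Local Notation G := (SL F N * SL F N)%type.

Lemma regular_mulr_SL (f : H -> F) h :
  regular_fun (@SL_coord F N) f -> regular_fun (@SL_coord F N) (fun g => f (g * h)%g).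
Proof.
by move=> fr; apply: regular_comp_SL fr => i j; exact: regular_mulr_entry.
Qed.

Lemma regular_mulr_SLxSL (f : G -> F) (h : G) :
  regular_fun (@SLxSL_coord F N) f -> regular_fun (@SLxSL_coord F N) (fun g => f (g * h)%g).
Proof.
move=> fr; apply: (@regular_comp_SLxSL _ _ _ _ _ (fun g : G => (g * h)%g)) fr => i j.
  exact: (regular_fst (regular_mulr_entry h.1 i j)).
exact: (regular_snd (regular_mulr_entry h.2 i j)).
Qed.

Lemma SL00_lowerM (u h : H) : lower_SL u -> SLval (u * h)%g 0 0 = SLval u 0 0 * SLval h 0 0.
Proof.
move=> /is_trig_mxP uL; rewrite SL_mulE mxE (bigD1 0) //= big1 ?addr0 // => i i0.
by rewrite uL ?mul0r // lt0n.
Qed.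

Lemma SL00_upperM (h b : H) : upper_SL b -> SLval (h * b)%g 0 0 = SLval h 0 0 * SLval b 0 0.
Proof.
move=> /upper_triangularP bU; rewrite SL_mulE mxE (bigD1 0) //= big1 ?addr0 // => i i0.
by rewrite bU ?mulr0 // lt0n.
Qed.

Lemma branching_data_mult : branching_data F lam k ->
  branching_mult F lam (omega n 1 *+ k) 1.
Proof.
move=> [T1 [T2 [q1 [q2 [Phi [C [[r1 r2] PhiM phiM [Phiu Phib Phi1] [Cinv C1]]]]]]]].
have [dV [rho [xi [v [c [_ [rrat [vcyc xcyc] PhiE cE _]]]]]]] :=
  positive_realization regular_mulr_SLxSL (@SLxSL_starK F n) r1 PhiM.
have [dW [sigma [zeta [w [_ [e [srat [wcyc zcyc] phiE _ eE]]]]]]] :=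
  positive_realization (Phi := fun h : H => SLval h 0 0 ^+ k)
    regular_mulr_SL (@SL_starK F n) r2 phiM.
have [rirr vB xB v0] := realization_irreducible (big_cell_SLxSL F lam) rrat vcyc xcyc
  PhiE Phiu Phib Phi1.
have [_ rhoM _] := rrat; have [sigma1 sigmaM _] := srat.
have [||| sirr wB _ w0] := realization_irreducible (big_cell_SL F (omega n 1 *+ k))
    srat wcyc zcyc phiE.
- by move=> u g uL; rewrite SL00_lowerM // exprMn (wt_SL_komega1 _ (or_introl uL)).
- by move=> b g bU; rewrite SL00_upperM // mulrC exprMn (wt_SL_komega1 _ (or_intror bU)).
- by rewrite /= mxE eqxx expr1n oner_eq0.
(* The columns [c t] and rows [e s] represent the two kinds of factors of [branching_form], so this
   matrix has that form as its coefficient. *)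
pose A := \sum_t \sum_s C t s *: (c t *m e s).
have AE p h : xi *m (rho p *m (A *m (sigma h *m w))) = (branching_form q1 q2 C p h)%:M.
  rewrite /A mulmx_suml !mulmx_sumr /branching_form raddf_sum; apply: eq_bigr => t _ /=.
  rewrite mulmx_suml !mulmx_sumr raddf_sum; apply: eq_bigr => s _ /=.
  rewrite -scalemxAl -!scalemxAr -mulmxA eE mul_mx_scalar -!scalemxAr cE.
  by rewrite !scale_scalar_mx [(_^*) * _]mulrC.
have Aint : intertwiner rho sigma A.
  move=> h; apply/eqP; rewrite -subr_eq0; apply/eqP.
  suff Ax (x : 'cV_dW) : (rho (h, h) *m A - A *m sigma h) *m x = 0.
    apply/matrixP => i j; have /matrixP/(_ i 0) := Ax (delta_mx j 0).
    by rewrite -colE !mxE.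
  apply: xcyc => p; rewrite !mulmxA -[RHS](mul0mx _ x); congr (_ *m x).
  apply: wcyc => h'; rewrite -!mulmxA mulmxBl !mulmxBr -!mulmxA.
  rewrite (mulmxA (rho p) (rho _)) -rhoM AE (mulmxA (sigma h)) -sigmaM AE.
  by rewrite Cinv subrr.
have A0 : A != 0.
  have [|h hE] := @exists_SL_col F n (const_mx 1) n_gt0; first by rewrite mxE oner_eq0.
  have h1 i : SLval h i 0 = 1 by have /matrixP/(_ i 0) := hE; rewrite !mxE.
  apply: contraNneq (C1 h h1) => Az; have /matrixP/(_ 0 0) := AE 1%g h.
  by rewrite Az mul0mx !mulmx0 !mxE mulr1n => <-.
exists dV, rho, dW, sigma; split.
- split=> //; exists v => // b b' bU bL.
  by rewrite (vB (b, b') (conj bU bL)).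
- by split=> //; exists w => // b bU; rewrite wB.
exists <[A]>%VS; last by rewrite dim_vline A0.
move=> B; split=> [/vlineP[a ->] h|Bint].
  by rewrite -scalemxAr Aint scalemxAl.
apply/vlineP.
exact: (intertwiner_line n_gt0 rrat srat xB xcyc wcyc zcyc phiE Aint Bint A0).
Qed.

Lemma branching_mult_exponents : branching_mult F lam (omega n 1 *+ k) 1 ->
  exists m : 'I_N -> nat,
    (forall j, torus_exponent k (lam.1 + lam.2) j = (N * m j)%:Z) /\
    forall (j : 'I_n) (b : nat), lam.2 0 j = - b%:Z -> (m (lift ord0 j) <= b)%N.
Proof.
move=> [dV [rho [dW [sigma [[rrat rirr [v v0 vB]] [srat sirr [w w0 wB]] [U UE dimU]]]]]].
have vcyc := irreducible_cyclic_col rrat rirr v0.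
have wcyc := irreducible_cyclic_col srat sirr w0.
have vB' : eigencol rho (@SLxSL_pos F n) (wt_SLxSL lam) v.
  by move=> [b b'] [bU bL]; rewrite vB.
have wB' : eigencol sigma (@upper_SL F n) (wt_SL (omega n 1 *+ k)) w.
  by move=> b bU; rewrite wB.
have [xi xB xiv] := exists_eigenrow (big_cell_SLxSL F lam) rrat v0 vB' vcyc.
have [zeta zB zw] := exists_eigenrow (big_cell_SL F (omega n 1 *+ k)) srat w0 wB' wcyc.
have row_neq0 d (x : 'rV[F]_d) (y : 'cV_d) : x *m y = 1%:M -> x != 0.
  move=> xy; apply/eqP => x0; move/matrixP/(_ 0 0): xy.
  by rewrite x0 mul0mx !mxE => /esym/eqP; rewrite oner_eq0.
have xcyc := irreducible_cyclic_row rrat rirr (row_neq0 _ _ _ xiv).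
have zcyc := irreducible_cyclic_row srat sirr (row_neq0 _ _ _ zw).
have [_ sigmaM _] := srat.
(* Both sides are regular with the same eigenvalues under the two Borel subgroups and the same value
   at 1, so they agree on the big cell. *)
have coefE h : zeta *m (sigma h *m w) = (SLval h 0 0 ^+ k)%:M.
  apply/matrixP => i j; rewrite !ord1 [RHS]mxE mulr1n; apply/eqP; rewrite -subr_eq0; apply/eqP.
  have fr : regular_fun (@SL_coord F N)
      (fun h => (zeta *m (sigma h *m w)) 0 0 - SLval h 0 0 ^+ k).
    apply: regularB; first exact: regular_mxcoef.
    by apply: regularX; exact: regular_entry.
  apply: (SL_big_cell_dense fr) => u b uL bU.
  rewrite sigmaM -mulmxA (mulmxA zeta) zB // wB' // -scalemxAl -scalemxAr zw.
  rewrite (wt_SL_komega1 _ (or_introl uL)) (wt_SL_komega1 _ (or_intror bU)) SL00_lowerM //.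
  by rewrite !mxE mulr1n mulr1 exprMn subrr.
have [A AU A0] : exists2 A, A \in U & A != 0.
  exists (vpick U); first exact: memv_pick.
  by rewrite vpick0 -dimv_eq0 dimU.
have Aint : intertwiner rho sigma A by apply/UE.
exact: (intertwiner_exponents n_gt0 rrat srat xB xcyc wcyc zcyc coefE Aint A0).
Qed.

End Multiplicity.

(** * The Pieri rule *)

Section HorizontalStrips.
Variable n : nat.
Implicit Types lam mu beta : ('rV[int]_n * 'rV[int]_n)%type.

(* The Pieri condition: [lam.1] is obtained from [- lam.2] by adding [k] boxes,
   [m j] of them in row [j], no two in the same column. *)
Definition horizontal_strip k lam := exists nu m : nat -> nat,
  (forall j : 'I_n, lam.1 0 j = (nu j + m j)%:Z /\ lam.2 0 j = - (nu j + m j.+1)%:Z) /\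
  (\sum_(j < n.+1) m j)%N = k.

Lemma sum_indicator (V : zmodType) (f : nat -> V) (x : nat) :
  \sum_(i < n) f i *+ (x == i) = if (x < n)%N then f x else 0.
Proof.
case: ltnP => xn.
  rewrite (bigD1 (Ordinal xn)) //= eqxx big1 ?addr0 // => i ix.
  by rewrite eq_sym (negPf (ix : (i : nat) != x)).
rewrite big1 // => i _; case: eqP => // xi.
by move: (ltn_ord i); rewrite -xi ltnNge xn.
Qed.

Lemma sum_omega (f : nat -> int) (j : 'I_n) :
  (\sum_(1 <= i < n.+1) omega n i *~ f i) 0 j = f j.+1.
Proof.
rewrite summxE big_add1 big_mkord /=.
transitivity (\sum_(i < n) f i.+1 *+ (j == i :> nat)).
  by apply: eq_bigr => i _; rewrite -scaler_int !mxE eqSS mulr_natr intz.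
by rewrite (sum_indicator (fun i => f i.+1)) ltn_ord.
Qed.

Lemma pair_sum (I : Type) (r : seq I) (P : pred I) (f g : I -> 'rV[int]_n) :
  \sum_(i <- r | P i) (f i, g i) = (\sum_(i <- r | P i) f i, \sum_(i <- r | P i) g i).
Proof. by elim/big_rec3: _ => [//|i x y z _ ->]. Qed.

Lemma pair_eqP lam mu : (forall j, lam.1 0 j = mu.1 0 j) ->
  (forall j, lam.2 0 j = mu.2 0 j) -> lam = mu.
Proof.
case: lam mu => x y [x' y'] /= xx yy.
by congr pair; apply/matrixP => i j; rewrite ord1.
Qed.

Lemma PG_coords (a b : nat -> nat) lam :
  lam = \sum_(1 <= i < n.+1) (omega n i, 0) *+ a i
       + \sum_(1 <= i < n.+1) (0, - omega n i) *+ b i ->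
  forall j, lam.1 0 j = (a j.+1)%:Z /\ lam.2 0 j = - (b j.+1)%:Z.
Proof.
have MnE (x y : 'rV[int]_n) m : (x, y) *+ m = (x *+ m, y *+ m).
  by elim: m => [|m IHm]; rewrite ?mulr0n // !mulrS IHm.
move=> -> j; under eq_bigr do rewrite MnE; rewrite pair_sum.
under [X in _ + X]eq_bigr do rewrite MnE; rewrite pair_sum /= !mxE.
split.
  rewrite [X in _ + X]summxE [X in _ + X]big1 ?addr0; last by move=> i _; rewrite mul0rn mxE.
  by rewrite (sum_omega (fun i => (a i)%:Z)).
rewrite [X in X + _]summxE [X in X + _]big1 ?add0r; last by move=> i _; rewrite mul0rn mxE.
under eq_bigr do rewrite mulNrn.
by rewrite sumrN mxE (sum_omega (fun i => (b i)%:Z)).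
Qed.

Lemma PG_of_coords (a b : nat -> nat) lam :
  (forall j : 'I_n, lam.1 0 j = (a j)%:Z /\ lam.2 0 j = - (b j)%:Z) -> PG n lam.
Proof.
move=> lamE; exists (fun i => a i.-1), (fun i => b i.-1).
have E := PG_coords (a := fun i => a i.-1) (b := fun i => b i.-1) erefl.
by apply: pair_eqP => j; [rewrite (E j).1 (lamE j).1|rewrite (E j).2 (lamE j).2].
Qed.

(** At $\omega_i$ the components are $k_i-k_{i-1}$ and $k_i-k_{i+1}$ with $k_0=0$ and $k_{n+1}=k$;
    the summand $(0,-k\omega_n)$ accounts for the last convention. Here $i$ is [j.+1]. *)
Lemma B_coords (c : nat -> int) (k : nat) (j : 'I_n) :
  let beta := \sum_(1 <= i < n.+1) alpha_tilde n i *~ c i + (0, - (omega n n *+ k)) in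
  beta.1 0 j = c j.+1 - (if j == 0 :> nat then 0 else c j) /\
  beta.2 0 j = c j.+1 - (if (j.+1 < n)%N then c j.+2 else k%:Z).
Proof.
have MzE (x y : 'rV[int]_n) m : (x, y) *~ m = (x *~ m, y *~ m).
  have MnE l : (x, y) *+ l = (x *+ l, y *+ l).
    by elim: l => [|l IHl]; rewrite ?mulr0n // !mulrS IHl.
  by case: m => l; rewrite /intmul MnE.
rewrite /alpha_tilde /=; under eq_bigr do rewrite MzE; rewrite pair_sum /=.
split.
  rewrite addr0 summxE big_add1 big_mkord /=.
  under eq_bigr do rewrite -scaler_int !mxE mulrBr intz !mulr_natr !eqSS.
  rewrite sumrB (sum_indicator (fun i => c i.+1)) ltn_ord; congr (_ - _).
  case: j => [[|j] jn] /=; first by rewrite big1.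
  under eq_bigr do rewrite eqSS.
  by rewrite (sum_indicator (fun i => c i.+1)) (ltnW jn).
rewrite mxE summxE big_add1 big_mkord /=.
under eq_bigr do rewrite -scaler_int !mxE mulrBr intz !mulr_natr eqSS.
rewrite sumrB (sum_indicator (fun i => c i.+1)) ltn_ord.
rewrite (sum_indicator (fun i => c i.+1)) [X in _ + X]mxE -addrA -opprD; congr (_ - _).
rewrite mulmxnE mxE; case: ltnP => jn.
  by rewrite (ltn_eqF jn) mul0rn addr0.
have -> : (j.+1 == n) = true by rewrite eqn_leq jn ltn_ord.
by rewrite add0r -natz.
Qed.

(** Take $k_i=m_0+\dots+m_{i-1}$: the differences are the $m_i$, and $k-k_n=m_n$. Subtracting
    removes the whole strip and leaves [nu]. *)
Lemma horizontal_strip_subr k lam : horizontal_strip k lam ->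
  exists2 beta, B_komega1 n k beta & horizontal_strip 0 (lam - beta).
Proof.
move=> [nu [m [lamE mk]]]; pose c i := (\sum_(0 <= j < i) m j)%N.
have cS i : c i.+1 = (c i + m i)%N by rewrite /c big_nat_recr.
have cn : (c n + m n)%N = k by rewrite -cS -mk /c big_mkord.
pose beta := \sum_(1 <= i < n.+1) alpha_tilde n i *~ (c i)%:Z + (0, - (omega n n *+ k)).
exists beta.
  exists (fun i => (c i)%:Z); split=> // [i _|]; first by rewrite cS; lia.
  by rewrite -cn; lia.
exists nu, (fun=> 0%N); split=> [j|]; last by rewrite big1.
have [b1 b2] := B_coords (fun i => (c i)%:Z) k j; have [l1 l2] := lamE j.
have -> : (lam - beta).1 0 j = lam.1 0 j - beta.1 0 j by rewrite !mxE.
have -> : (lam - beta).2 0 j = lam.2 0 j - beta.2 0 j by rewrite !mxE.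
rewrite [beta.1 0 j]b1 [beta.2 0 j]b2 l1 l2 cS; split.
  case: eqP => [->|_]; last by lia.
  by rewrite /c big_geq //; lia.
case: ltnP => jn; first by rewrite !cS; lia.
have jE : j.+1 = n by apply/eqP; rewrite eqn_leq jn ltn_ord.
have: (c j.+1 + m j.+1)%N = k by rewrite jE.
by rewrite cS; lia.
Qed.

Lemma horizontal_strip_addr k lam beta : (0 < n)%N -> horizontal_strip 0 lam ->
  B_komega1 n k beta -> horizontal_strip k (lam + beta).
Proof.
move=> n_gt0 [nu [m [lamE m0]]] [c [c1 cmono ck ->]].
have {}lamE (j : 'I_n) : lam.1 0 j = (nu j)%:Z /\ lam.2 0 j = - (nu j)%:Z.
  have mz i : (i < n.+1)%N -> m i = 0%N.
    move=> iN; apply/eqP; rewrite -leqn0 -m0 (bigD1 (Ordinal iN)) //=; exact: leq_addr.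
  have [-> ->] := lamE j.
  by rewrite !mz ?addn0 // ?ltnS // ltnW.
(* The sequence is only constrained between 1 and [n]; it is extended by 0 at index 0 and by [k]
   beyond [n], so that its increments are nonnegative and telescope to [k]. *)
pose c' i : int := if i == 0%N then 0 else if (i <= n)%N then c i else k%:Z.
pose d i := `|c' i.+1 - c' i|%N.
have dE i : (i <= n)%N -> (d i)%:Z = c' i.+1 - c' i.
  move=> ni; rewrite /d gez0_abs // /c' /=.
  case: i ni => [|i] ni /=; first by rewrite n_gt0 subr0.
  rewrite ni; case: ltnP => ni'; first by rewrite subr_ge0 cmono.
  by have -> : i.+1 = n; [apply/eqP; rewrite eqn_leq ni | rewrite subr_ge0].
exists nu, d; split=> [j|].
  have [b1 b2] := B_coords c k j; have [l1 l2] := lamE j.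
  set be := (X in lam + X).
  have -> : (lam + be).1 0 j = lam.1 0 j + be.1 0 j by rewrite mxE.
  have -> : (lam + be).2 0 j = lam.2 0 j + be.2 0 j by rewrite mxE.
  rewrite [be.1 0 j]b1 [be.2 0 j]b2 l1 l2 !PoszD !dE //; last exact: ltnW.
  rewrite /c' /= ltn_ord; split.
    by congr (_ + (_ - _)); case: eqP => // _; rewrite ltnW.
  by case: ltnP => _; ring.
apply/eqP; rewrite -eqz_nat -natz natr_sum.
under eq_bigr => i _ do rewrite natz dE -1?ltnS //.
rewrite -(big_mkord xpredT (fun i => c' i.+1 - c' i)) telescope_sumr //.
by rewrite /c' /= ltnn subr0.
Qed.

Variable F : numClosedFieldType.
Hypothesis n_gt0 : (0 < n)%N.

Lemma horizontal_strip_mult k lam :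
  horizontal_strip k lam -> branching_mult F lam (omega n 1 *+ k) 1.
Proof.
move=> [nu [m [lamE <-]]]; apply: branching_data_mult => //.
pose S1 := \sum_(i < n) (omega n i.+1, - omega n i.+1) *+ nu i.
(* Box number [i] of the strip contributes $(\omega_{i+1},-\omega_i)$; the end terms are
   $(\omega_1,0)$ and $(0,-\omega_n)$. *)
pose S2 := \sum_(i < n.+1) (omega n i.+1, - omega n i) *+ m i.
have -> : lam = S1 + S2.
  have MnE (x y : 'rV[int]_n) l : (x, y) *+ l = (x *+ l, y *+ l).
    by elim: l => [|l IHl]; rewrite ?mulr0n // !mulrS IHl.
  rewrite /S1 /S2; under eq_bigr do rewrite MnE.
  under [X in _ + X]eq_bigr do rewrite MnE.
  rewrite !pair_sum; apply: pair_eqP => j /=.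
    rewrite (lamE j).1 mxE !summxE PoszD; congr (_ + _).
      under eq_bigr do rewrite mulmxnE mxE eqSS -mulrnA mulnC mulrnA natz.
      by rewrite (sum_indicator (fun i => (nu i)%:Z)) ltn_ord.
    rewrite big_ord_recr /=.
    under eq_bigr do rewrite mulmxnE mxE eqSS -mulrnA mulnC mulrnA natz.
    rewrite (sum_indicator (fun i => (m i)%:Z)) ltn_ord mulmxnE mxE eqSS.
    by rewrite (ltn_eqF (ltn_ord j)) mul0rn addr0.
  rewrite (lamE j).2 mxE !summxE PoszD opprD; congr (_ + _).
    under eq_bigr do rewrite mulmxnE !mxE eqSS mulNrn -mulrnA mulnC mulrnA natz.
    by rewrite sumrN (sum_indicator (fun i => (nu i)%:Z)) ltn_ord.
  rewrite big_ord_recl /= mulmxnE !mxE oppr0 mul0rn add0r.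
  under eq_bigr do rewrite mulmxnE !mxE /bump add1n eqSS mulNrn -mulrnA mulnC mulrnA natz.
  by rewrite sumrN (sum_indicator (fun i => (m i.+1)%:Z)) ltn_ord.
have -> : (\sum_(j < n.+1) m j = \sum_(i < n) 0 * nu i + \sum_(j < n.+1) 1 * m j)%N.
  by rewrite [X in (X + _)%N]big1 ?add0n //; apply: eq_bigr => i _; rewrite mul1n.
apply: branching_dataM; apply: branching_data_sum => i; apply: branching_dataX.
  exact: branching_data_spherical (ltnW (ltn_ord (lift ord0 i))).
exact: branching_data_fundamental.
Qed.

(** The partition is $\nu_j=b_{j+1}-m_{j+1}$, nonnegative by the $\mathrm{SL}_2$ bound; the torus
    weight then forces $a_{j+1}=\nu_j+m_j$, and the sum of the exponents gives the size [k]. *)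
Lemma mult_horizontal_strip k lam :
  PG n lam -> branching_mult F lam (omega n 1 *+ k) 1 -> horizontal_strip k lam.
Proof.
move=> [a [b /PG_coords lamE]] /(branching_mult_exponents n_gt0)[m [mE mb]].
pose m' i := m (inord i).
have m0E (j : 'I_n) : m' j = m (widen_ord (leqnSn n) j).
  by congr m; apply/val_inj; rewrite /= inordK // ltnW // ltnS.
have m1E (j : 'I_n) : m' j.+1 = m (lift ord0 j).
  by congr m; apply/val_inj; rewrite /= inordK // ltnS.
have m1b (j : 'I_n) : (m' j.+1 <= b j.+1)%N by rewrite m1E mb //; exact: (lamE j).2.
have mab (j : 'I_n) : (m' j)%:Z - (m' j.+1)%:Z = (a j.+1)%:Z - (b j.+1)%:Z.
  have := torus_exponent_diff k (lam.1 + lam.2) j.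
  rewrite !mE -m0E -m1E mxE (lamE j).1 (lamE j).2 !PoszM -mulrBr => /mulfI; exact.
exists (fun i => b i.+1 - m' i.+1)%N, m'; split=> [j|].
  rewrite (lamE j).1 (lamE j).2 subnK //; split=> //.
  by have := mab j; have := m1b j; lia.
have := sum_torus_exponent k (lam.1 + lam.2).
under eq_bigr do rewrite mE PoszM.
rewrite -mulr_sumr => /mulfI E; apply/eqP; rewrite -eqz_nat -E //.
rewrite -!natz natr_sum; apply/eqP/eq_bigr => i _; rewrite natz.
by rewrite /m' inord_val.
Qed.

Lemma horizontal_stripP k lam :
  PG_mu F (omega n 1 *+ k) lam <-> horizontal_strip k lam.
Proof.
split=> [[]|st]; first exact: mult_horizontal_strip.
split; last exact: horizontal_strip_mult.
have [nu [m [lamE _]]] := st.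
exact: (@PG_of_coords (fun i => nu i + m i)%N (fun i => nu i + m i.+1)%N).
Qed.

End HorizontalStrips.

Local Open Scope classical_set_scope.
Local Open Scope complex_scope.

Theorem proposition4p3 (R : realType) (n k : nat) (hn : (1 <= n)%N) :
  PG_mu R[i] (omega n 1 *+ k) =
  [set lam + beta | lam in PG_mu R[i] (0 : 'rV[int]_n) & beta in B_komega1 n k].
Proof.
(* The zero weight is $k\omega_1$ with $k=0$, so the strip criterion applies to both sides. *)
rewrite -[0 in RHS](mulr0n (omega n 1)); apply/seteqP; split=> lam.
  move=> /(horizontal_stripP _ hn)/horizontal_strip_subr[beta betaB lamB].
  exists (lam - beta); first exact/(horizontal_stripP _ hn).
  by exists beta => //; rewrite subrK.
move=> [mu /(horizontal_stripP _ hn) muS [beta betaB <-]].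
by apply/(horizontal_stripP _ hn); exact: horizontal_strip_addr.
Qed.
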